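(* Let $A$ and $C$ be positive real constants. The metric entropy of the class $\mathcal{F}_{\mathrm{exp}}^{A,C}$ equipped with the metric $d_1$ satisfies $$H\left(\varepsilon;\mathcal{F}_{\mathrm{exp}}^{A,C},d_1\right)=\frac{\log^2(\varepsilon^{-1})}{\log^{(2)}(\varepsilon^{-1})}\left(1+\frac{\log^{(3)}(\varepsilon^{-1})}{\log^{(2)}(\varepsilon^{-1})}+o_{\varepsilon\to0}\left(\frac{\log^{(3)}(\varepsilon^{-1})}{\log^{(2)}(\varepsilon^{-1})}\right)\right).$$
   Context: $\log$ is the logarithm to base $2$, $\log^{(k)}$ is its $k$-fold iterate, and $\log^2(x)=(\log x)^2$. $\mathcal{F}_{\mathrm{exp}}^{A,C}$ is the class of entire functions $f$ such that $|f(z)|\le Ce^{A|z|}$ for all $z\in\mathbb{C}$. The metric is $d_1(f_1,f_2)=\sup_{z\in D(0;1)}|f_1(z)-f_2(z)|$, where $D(0;1)$ is the open unit disk in $\mathbb{C}$. Metric entropy: for a subset $\mathcal{K}$ of a metric space $(\mathcal{X},d)$, an $\varepsilon$-covering is a set $\{x_1,\dots,x_N\}\subseteq\mathcal{X}$ such that every $x\in\mathcal{K}$ has some $i$ with $d(x,x_i)\le\varepsilon$; $N(\varepsilon;\mathcal{K},d)$ is the cardinality of a smallest $\varepsilon$-covering and $H(\varepsilon;\mathcal{K},d)=\log_2N(\varepsilon;\mathcal{K},d)$. Here the ambient space $\mathcal{X}$ is the space of bounded analytic functions on $D(0;1)$ with the metric $d_1$. *)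

(* Defs.v *)
From Stdlib Require Import Reals Lra List Arith.
From Stdlib Require Import ClassicalEpsilon FunctionalExtensionality ProofIrrelevance.
From Coquelicot Require Import Coquelicot.
Open Scope R_scope.

Definition log2 (x : R) : R := ln x / ln 2.

Definition log_iter (k : nat) (x : R) : R := Nat.iter k log2 x.

Section MetricEntropy.

Variable X : Metric_Space.

(* The list [l] enumerates a finite set of points of the ambient space, which
   need not lie in [K]. *)
Definition is_covering (K : Base X -> Prop) (eps : R) (l : list (Base X)) : Prop :=
  NoDup l /\ forall x, K x -> exists y, In y l /\ dist X x y <= eps.

Definition is_covering_number (K : Base X -> Prop) (eps : R) (N : nat) : Prop :=
  (exists l, is_covering K eps l /\ length l = N) /\
  (forall l, is_covering K eps l -> (N <= length l)%nat).

(* Meaningful only when [K] has a finite [eps]-covering; otherwise an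
   unspecified natural number. *)
Definition covering_number (K : Base X -> Prop) (eps : R) : nat :=
  epsilon (inhabits 0%nat) (is_covering_number K eps).

Definition metric_entropy (K : Base X -> Prop) (eps : R) : R :=
  log2 (INR (covering_number K eps)).

End MetricEntropy.

Definition unit_disk : Type := {z : C | Cmod z < 1}.

Definition unit_disk_point (w : unit_disk) : C := proj1_sig w.
Coercion unit_disk_point : unit_disk >-> C.

(* Values of the extension [F] outside the open disk are irrelevant, since
   complex differentiability is only required at points of the disk. *)
Definition analytic_on_disk (f : unit_disk -> C) : Prop :=
  exists F : C -> C,
    (forall z : C, Cmod z < 1 -> @ex_derive C_AbsRing C_NormedModule F z) /\
    (forall w : unit_disk, f w = F w).

Definition bounded_on_disk (f : unit_disk -> C) : Prop :=
  exists M : R, forall w : unit_disk, Cmod (f w) <= M.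

Definition bounded_analytic : Type :=
  {f : unit_disk -> C | analytic_on_disk f /\ bounded_on_disk f}.

Definition ba_fun (f : bounded_analytic) : unit_disk -> C := proj1_sig f.
Coercion ba_fun : bounded_analytic >-> Funclass.

(* The least upper bound is finite on bounded functions, see [d1_ub]. *)
Definition d1 (f g : bounded_analytic) : R :=
  real (Lub_Rbar (fun x => exists w : unit_disk, x = Cmod (f w - g w)%C)).

Lemma Cmod_0_lt_1 : Cmod (RtoC 0) < 1.
Proof. rewrite Cmod_0; lra. Qed.

Definition disk_center : unit_disk := exist (fun z : C => Cmod z < 1) (RtoC 0) Cmod_0_lt_1.

Lemma d1_is_lub (f g : bounded_analytic) :
  is_lub_Rbar (fun x => exists w : unit_disk, x = Cmod (f w - g w)%C) (d1 f g).
Proof.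
unfold d1.
set (E := fun x => exists w : unit_disk, x = Cmod (f w - g w)%C).
destruct (proj2 (proj2_sig f)) as [Mf Hf].
destruct (proj2 (proj2_sig g)) as [Mg Hg].
pose proof (Lub_Rbar_correct E) as H.
assert (Hub : Rbar_le (Lub_Rbar E) (Finite (Mf + Mg))).
{ apply (proj2 H); intros x [w ->]; simpl.
  unfold Cminus; eapply Rle_trans; [apply Cmod_triangle|].
  rewrite Cmod_opp; apply Rplus_le_compat; [apply Hf | apply Hg]. }
assert (Hlb : Rbar_le (Finite (Cmod (f disk_center - g disk_center)%C)) (Lub_Rbar E)).
{ apply (proj1 H); now exists disk_center. }
destruct (Lub_Rbar E) as [r| |]; simpl in *; try contradiction; exact H.
Qed.

Lemma d1_ub (f g : bounded_analytic) (w : unit_disk) :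
  Cmod (f w - g w)%C <= d1 f g.
Proof. apply (proj1 (d1_is_lub f g)); now exists w. Qed.

Lemma d1_least (f g : bounded_analytic) (M : R) :
  (forall w : unit_disk, Cmod (f w - g w)%C <= M) -> d1 f g <= M.
Proof.
intros H; apply (proj2 (d1_is_lub f g) (Finite M)).
intros x [w ->]; apply H.
Qed.

Lemma d1_pos (f g : bounded_analytic) : d1 f g >= 0.
Proof.
apply Rle_ge; eapply Rle_trans; [apply Cmod_ge_0 | apply (d1_ub f g disk_center)].
Qed.

Lemma Cmod_minus_sym (x y : C) : Cmod (x - y)%C = Cmod (y - x)%C.
Proof. rewrite <- Cmod_opp; f_equal; ring. Qed.

Lemma d1_sym (f g : bounded_analytic) : d1 f g = d1 g f.
Proof.
apply Rle_antisym; apply d1_least; intros w; rewrite Cmod_minus_sym; apply d1_ub.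
Qed.

Lemma d1_refl (f g : bounded_analytic) : d1 f g = 0 <-> f = g.
Proof.
split.
- intros H.
  assert (Hfg : forall w, f w = g w).
  { intros w.
    assert (H0 : Cmod (f w - g w)%C = 0).
    { apply Rle_antisym; [rewrite <- H; apply d1_ub | apply Cmod_ge_0]. }
    apply Cmod_eq_0 in H0.
    replace (f w) with ((f w - g w) + g w)%C by ring.
    rewrite H0; ring. }
  destruct f as [f pf], g as [g pg]; simpl in Hfg.
  assert (E : f = g) by (apply functional_extensionality; exact Hfg).
  subst g; rewrite (proof_irrelevance _ pf pg); reflexivity.
- intros ->; apply Rle_antisym; [|apply Rge_le, d1_pos].
  apply d1_least; intros w.
  replace (g w - g w)%C with (RtoC 0) by ring; rewrite Cmod_0; lra.
Qed.

Lemma d1_tri (f g h : bounded_analytic) : d1 f g <= d1 f h + d1 h g.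
Proof.
apply d1_least; intros w.
replace (f w - g w)%C with ((f w - h w) + (h w - g w))%C by ring.
eapply Rle_trans; [apply Cmod_triangle|].
apply Rplus_le_compat; apply d1_ub.
Qed.

Definition bounded_analytic_space : Metric_Space :=
  Build_Metric_Space bounded_analytic d1 d1_pos d1_sym d1_refl d1_tri.

Definition entire (f : C -> C) : Prop :=
  forall z : C, @ex_derive C_AbsRing C_NormedModule f z.

Definition F_exp (A B : R) (f : C -> C) : Prop :=
  entire f /\ forall z : C, Cmod (f z) <= B * exp (A * Cmod z).

(* [F_exp A B] as a subset of the ambient metric space: an entire function is
   identified with its restriction to the open unit disk. *)
Definition F_exp_disk (A B : R) : Base bounded_analytic_space -> Prop :=
  fun g : bounded_analytic =>
    exists f : C -> C, F_exp A B f /\ forall w : unit_disk, g w = f w.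

(* Main.v *)
Require Import Defs.
From Stdlib Require Import Reals Lra Lia ZArith List Factorial.
From Stdlib Require Import ClassicalEpsilon FunctionalExtensionality.
From Coquelicot Require Import Coquelicot.
Open Scope R_scope.

(** Up to factors that do not matter at the stated precision, the class is a
product of disks of Taylor coefficients, the [k]-th one of radius
[(k + 2) ^ (- k)].

Cauchy's estimates on the circle of radius [k + 2] bound the [k]-th coefficient
of a function of the class by [exp (O (k + 1)) / (k + 2) ^ k], and bound in the
same way the error, on the unit disk, of its Taylor polynomial with [k] terms.
Rounding the first [n] coefficients to a square grid therefore yields a
covering as soon as the [n]-term error is below [eps / 2] ([covering_upper]).
Conversely, polynomials with [|a k| <= B * A ^ k / k!] are in the class, because
they are dominated by the exponential series, and a coefficient is at most the
supremum on the disk; so polynomials with coefficients on a grid of mesh [3 eps]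
are more than [2 eps] apart, and a covering needs one ball for each of them
([covering_lower]).

Let [l = ln (1 / eps)] and let [n] be such that [n ln (n + 2) = l + O(n)]: this is
the number of coefficients that are visible at the scale [eps].  The logarithms
of both counts are
[sum_{k < n} 2 (l - k ln (k + 2)) + O(n^2) = 2 n l - n^2 ln (n + 2) + O(n^2)
= n l + O(n^2)] ([entropy_estimate]).  In base 2, with [L = log2 (1 / eps)] and
[D = L / n = log2 n + O(1)], one has [Y = log2 L = log2 n + log2 D =
D + log2 D + O(1)], whence
[H Y / L^2 = Y / D + O(Y / D^2) = 1 + log2 Y / Y + O(1 / D)],
and [1 / D] is negligible with respect to [log2 Y / Y]
([asymptotic_expansion]).

The Taylor expansion has to be obtained from complex differentiability at every
point, without continuity of the derivative.  For [|w| < 1] and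
a circle [gamma] around the origin, the integral of [f z / (z - w)] along the
loop [w + s (gamma - w)] does not depend on [s]: this is Goursat's bisection
argument, carried out on rectangles of the parameters [s] and [t]
([loop_integral_invariant]).  Letting [s] tend to 0 gives Cauchy's formula
([Cauchy_formula]), and a finite geometric expansion of its kernel gives the
Taylor polynomials with their remainders ([entire_Taylor]). *)

(** * Integrals of complex functions of a real variable *)

(** Continuity is taken componentwise, so that sums, products and inverses reduce
to real functions; [Ccontinuous_eps] is the form that composes with complex
functions. *)
Definition Ccontinuous (f : R -> C) (t : R) : Prop :=
  continuous (fun u => Re (f u)) t /\ continuous (fun u => Im (f u)) t.

Definition CInt (f : R -> C) (a b : R) : C :=
  (RInt (fun t => Re (f t)) a b, RInt (fun t => Im (f t)) a b).

Lemma C_ext (z z' : C) : Re z = Re z' -> Im z = Im z' -> z = z'.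
Proof. destruct z, z'; simpl; congruence. Qed.

Lemma Re_le_Cmod (z : C) : Rabs (Re z) <= Cmod z.
Proof. eapply Rle_trans; [apply Rmax_l | apply Rmax_Cmod]. Qed.

Lemma Im_le_Cmod (z : C) : Rabs (Im z) <= Cmod z.
Proof. eapply Rle_trans; [apply Rmax_r | apply Rmax_Cmod]. Qed.

Lemma Cmod_le_Re_Im (z : C) : Cmod z <= Rabs (Re z) + Rabs (Im z).
Proof.
replace z with (RtoC (Re z) + RtoC (Im z) * Ci)%C at 1
  by (apply C_ext; simpl; ring).
eapply Rle_trans; [apply Cmod_triangle|].
rewrite Cmod_mult, Cmod_Ci, !Cmod_R; lra.
Qed.

Lemma continuous_R_eps (f : R -> R) (t : R) :
  continuous f t <->
  forall e, 0 < e -> exists d, 0 < d /\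
    forall u, Rabs (u - t) < d -> Rabs (f u - f t) < e.
Proof.
split.
- intros H e He.
  destruct (proj1 (filterlim_locally _ _) H (mkposreal e He)) as [d Hd].
  exists d; split; [apply cond_pos|]; intros u Hu; apply Hd, Hu.
- intros H; apply filterlim_locally; intros e.
  destruct (H e (cond_pos e)) as [d [Hd H']].
  exists (mkposreal d Hd); intros u Hu; apply H', Hu.
Qed.

Lemma Ccontinuous_eps (f : R -> C) (t : R) :
  Ccontinuous f t <->
  forall e, 0 < e -> exists d, 0 < d /\
    forall u, Rabs (u - t) < d -> Cmod (f u - f t) < e.
Proof.
unfold Ccontinuous; rewrite !continuous_R_eps; split.
- intros [Hr Hi] e He.
  destruct (Hr (e / 2)) as [d1 [Hd1 H1]]; [lra|].
  destruct (Hi (e / 2)) as [d2 [Hd2 H2]]; [lra|].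
  exists (Rmin d1 d2); split; [now apply Rmin_glb_lt|].
  intros u Hu.
  pose proof (Rmin_l d1 d2); pose proof (Rmin_r d1 d2).
  specialize (H1 u ltac:(lra)); specialize (H2 u ltac:(lra)).
  eapply Rle_lt_trans; [apply Cmod_le_Re_Im|].
  change (Rabs (Re (f u) - Re (f t)) + Rabs (Im (f u) - Im (f t)) < e); lra.
- intros H; split; intros e He; destruct (H e He) as [d [Hd H']];
    exists d; (split; [exact Hd|]); intros u Hu;
    (eapply Rle_lt_trans; [|apply (H' u Hu)]);
    [apply (Re_le_Cmod (f u - f t)%C) | apply (Im_le_Cmod (f u - f t)%C)].
Qed.

Lemma Ccontinuous_const (c : C) (t : R) : Ccontinuous (fun _ => c) t.
Proof. split; apply continuous_const. Qed.

Lemma Ccontinuous_RtoC (f : R -> R) (t : R) :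
  continuous f t -> Ccontinuous (fun u => RtoC (f u)) t.
Proof. intros H; split; [exact H | apply continuous_const]. Qed.

Lemma Ccontinuous_plus (f g : R -> C) (t : R) :
  Ccontinuous f t -> Ccontinuous g t -> Ccontinuous (fun u => f u + g u)%C t.
Proof.
intros [H1 H2] [H3 H4]; split.
- apply (continuous_plus (fun u => Re (f u)) (fun u => Re (g u))); assumption.
- apply (continuous_plus (fun u => Im (f u)) (fun u => Im (g u))); assumption.
Qed.

Lemma Ccontinuous_opp (f : R -> C) (t : R) :
  Ccontinuous f t -> Ccontinuous (fun u => - f u)%C t.
Proof.
intros [H1 H2]; split.
- apply (continuous_opp (fun u => Re (f u))); assumption.
- apply (continuous_opp (fun u => Im (f u))); assumption.
Qed.

Lemma Ccontinuous_minus (f g : R -> C) (t : R) :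
  Ccontinuous f t -> Ccontinuous g t -> Ccontinuous (fun u => f u - g u)%C t.
Proof.
intros Hf Hg; apply Ccontinuous_plus; [|apply Ccontinuous_opp]; assumption.
Qed.

Lemma Ccontinuous_mult (f g : R -> C) (t : R) :
  Ccontinuous f t -> Ccontinuous g t -> Ccontinuous (fun u => f u * g u)%C t.
Proof.
intros [H1 H2] [H3 H4]; split.
- apply (continuous_minus (fun u => Re (f u) * Re (g u)) (fun u => Im (f u) * Im (g u)));
  apply (continuous_mult (K := R_AbsRing)); assumption.
- apply (continuous_plus (fun u => Re (f u) * Im (g u)) (fun u => Im (f u) * Re (g u)));
  apply (continuous_mult (K := R_AbsRing)); assumption.
Qed.

Lemma Ccontinuous_inv (f : R -> C) (t : R) :
  f t <> 0 -> Ccontinuous f t -> Ccontinuous (fun u => / f u)%C t.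
Proof.
intros Hf [H1 H2].
assert (sq : forall g : R -> R, continuous g t -> continuous (fun u => g u ^ 2) t).
{ intros g Hg; apply (continuous_ext (fun u => mult (g u) (g u))).
  - intros u; unfold mult; simpl; ring.
  - now apply (continuous_mult (K := R_AbsRing)). }
assert (Hn : continuous (fun u => / (Re (f u) ^ 2 + Im (f u) ^ 2)) t).
{ apply (continuous_comp (fun u => Re (f u) ^ 2 + Im (f u) ^ 2) Rinv).
  - apply (continuous_plus (fun u => Re (f u) ^ 2) (fun u => Im (f u) ^ 2)); now apply sq.
  - apply continuous_Rinv; intros H0; apply Hf.
    apply Cmod_eq_0; unfold Cmod; unfold Re, Im in H0; rewrite H0; apply sqrt_0. }
split.
- apply (continuous_mult (K := R_AbsRing) (fun u => Re (f u))); assumption.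
- apply (continuous_mult (K := R_AbsRing) (fun u => - Im (f u))); [|assumption].
  apply (continuous_opp (fun u => Im (f u))); assumption.
Qed.

Lemma Ccontinuous_pow (f : R -> C) (n : nat) (t : R) :
  Ccontinuous f t -> Ccontinuous (fun u => f u ^ n)%C t.
Proof.
intros H; induction n as [|n IH]; [apply Ccontinuous_const|].
now apply Ccontinuous_mult.
Qed.

Lemma CInt_ext (f g : R -> C) (a b : R) :
  a <= b -> (forall t, a <= t <= b -> f t = g t) -> CInt f a b = CInt g a b.
Proof.
intros Hab H; unfold CInt; f_equal; apply RInt_ext; intros t Ht;
  rewrite Rmin_left, Rmax_right in Ht by exact Hab; rewrite H by lra; reflexivity.
Qed.

Section CIntContinuous.

Variables a b : R.
Hypothesis hab : a <= b.
Let cont (f : R -> C) : Prop := forall t, a <= t <= b -> Ccontinuous f t.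

Lemma ex_RInt_Re (f : R -> C) : cont f -> ex_RInt (fun t => Re (f t)) a b.
Proof.
intros H; apply (ex_RInt_continuous (V := R_CompleteNormedModule)).
intros t Ht; rewrite Rmin_left, Rmax_right in Ht by exact hab; exact (proj1 (H t Ht)).
Qed.

Lemma ex_RInt_Im (f : R -> C) : cont f -> ex_RInt (fun t => Im (f t)) a b.
Proof.
intros H; apply (ex_RInt_continuous (V := R_CompleteNormedModule)).
intros t Ht; rewrite Rmin_left, Rmax_right in Ht by exact hab; exact (proj2 (H t Ht)).
Qed.

Lemma CInt_plus (f g : R -> C) : cont f -> cont g ->
  CInt (fun t => f t + g t)%C a b = (CInt f a b + CInt g a b)%C.
Proof.
intros Hf Hg; apply C_ext; simpl.
- apply (RInt_plus (V := R_CompleteNormedModule) (fun t => Re (f t)) (fun t => Re (g t)));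
  now apply ex_RInt_Re.
- apply (RInt_plus (V := R_CompleteNormedModule) (fun t => Im (f t)) (fun t => Im (g t)));
  now apply ex_RInt_Im.
Qed.

Lemma CInt_scal (c : C) (f : R -> C) : cont f ->
  CInt (fun t => c * f t)%C a b = (c * CInt f a b)%C.
Proof.
intros Hf.
pose proof (ex_RInt_Re f Hf) as Hr; pose proof (ex_RInt_Im f Hf) as Hi.
assert (E : forall k (h : R -> R), ex_RInt h a b -> ex_RInt (fun t => scal k (h t)) a b)
  by (intros; now apply (ex_RInt_scal (V := R_NormedModule))).
assert (S : forall k (h : R -> R), ex_RInt h a b ->
  RInt (fun t => scal k (h t)) a b = scal k (RInt h a b))
  by (intros; now apply (RInt_scal (V := R_CompleteNormedModule))).
apply C_ext.
- change (RInt (fun t => minus (scal (Re c) (Re (f t))) (scal (Im c) (Im (f t)))) a b =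
    Re c * RInt (fun t => Re (f t)) a b - Im c * RInt (fun t => Im (f t)) a b).
  etransitivity; [apply (RInt_minus (V := R_CompleteNormedModule)
    (fun t => scal (Re c) (Re (f t))) (fun t => scal (Im c) (Im (f t)))); auto|].
  now rewrite !S.
- change (RInt (fun t => plus (scal (Re c) (Im (f t))) (scal (Im c) (Re (f t)))) a b =
    Re c * RInt (fun t => Im (f t)) a b + Im c * RInt (fun t => Re (f t)) a b).
  etransitivity; [apply (RInt_plus (V := R_CompleteNormedModule)
    (fun t => scal (Re c) (Im (f t))) (fun t => scal (Im c) (Re (f t)))); auto|].
  now rewrite !S.
Qed.

Lemma CInt_minus (f g : R -> C) : cont f -> cont g ->
  CInt (fun t => f t - g t)%C a b = (CInt f a b - CInt g a b)%C.
Proof.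
intros Hf Hg.
rewrite (CInt_ext _ (fun t => f t + (-1) * g t)%C) by (exact hab || (intros; ring)).
rewrite CInt_plus, CInt_scal; try assumption; [ring|].
intros t Ht; apply Ccontinuous_mult; [apply Ccontinuous_const | now apply Hg].
Qed.

Lemma CInt_const (c : C) : CInt (fun _ => c) a b = (RtoC (b - a) * c)%C.
Proof.
assert (E : forall x : R, RInt (fun _ => x) a b = (b - a) * x)
  by (intros; apply (RInt_const (V := R_CompleteNormedModule))).
apply C_ext.
- change (@eq R (RInt (fun _ => Re c) a b) ((b - a) * Re c - 0 * Im c)); rewrite E; ring.
- change (@eq R (RInt (fun _ => Im c) a b) ((b - a) * Im c + 0 * Re c)); rewrite E; ring.
Qed.

Lemma CInt_bound (f : R -> C) (M : R) : cont f ->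
  (forall t, a <= t <= b -> Cmod (f t) <= M) ->
  Cmod (CInt f a b) <= (b - a) * M.
Proof.
intros Hf HM.
pose proof (ex_RInt_Re f Hf) as Hr; pose proof (ex_RInt_Im f Hf) as Hi.
(* Integrating the pair of components as a vector of the normed plane gives the
   constant 1; bounding each component separately would give 2. *)
assert (H := is_RInt_fct_extend_pair (U := R_NormedModule) (V := R_NormedModule)
  f a b _ _ (RInt_correct (V := R_CompleteNormedModule) _ _ _ Hr)
            (RInt_correct (V := R_CompleteNormedModule) _ _ _ Hi)).
assert (Hn : forall z : C, @norm _ (prod_NormedModule R_AbsRing R_NormedModule R_NormedModule) z = Cmod z).
{ intros z; unfold norm, Cmod; simpl; unfold prod_norm, norm; simpl.
  unfold abs; simpl; f_equal; unfold Rsqr; rewrite !Rmult_1_r, <- !Rabs_mult.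
  f_equal; apply Rabs_right, Rle_ge, Rle_0_sqr. }
rewrite <- Hn.
apply (norm_RInt_le_const f a b _ M hab); [|exact H].
intros t Ht; rewrite Hn; now apply HM.
Qed.

End CIntContinuous.

Lemma CInt_Chasles (f : R -> C) (a b c : R) : a <= b -> b <= c ->
  (forall t, a <= t <= c -> Ccontinuous f t) ->
  (CInt f a b + CInt f b c)%C = CInt f a c.
Proof.
intros Hab Hbc Hf.
assert (H1 : forall t, a <= t <= b -> Ccontinuous f t) by (intros; apply Hf; lra).
assert (H2 : forall t, b <= t <= c -> Ccontinuous f t) by (intros; apply Hf; lra).
apply C_ext; simpl.
- apply (RInt_Chasles (V := R_CompleteNormedModule) (fun t => Re (f t))); now apply ex_RInt_Re.
- apply (RInt_Chasles (V := R_CompleteNormedModule) (fun t => Im (f t))); now apply ex_RInt_Im.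
Qed.

Lemma CInt_derive (f df : R -> C) (a b : R) : a <= b ->
  (forall t, is_derive (fun u => Re (f u)) t (Re (df t))) ->
  (forall t, is_derive (fun u => Im (f u)) t (Im (df t))) ->
  (forall t, Ccontinuous df t) ->
  CInt df a b = (f b - f a)%C.
Proof.
intros Hab Hr Hi Hc; apply C_ext; simpl; apply is_RInt_unique.
- apply (is_RInt_derive (V := R_CompleteNormedModule) (fun u => Re (f u)));
  intros; [apply Hr | apply Hc].
- apply (is_RInt_derive (V := R_CompleteNormedModule) (fun u => Im (f u)));
  intros; [apply Hi | apply Hc].
Qed.

(** * Circles *)

Definition cis (t : R) : C := (cos t, sin t).

Lemma Cmod_cis (t : R) : Cmod (cis t) = 1.
Proof.
unfold Cmod, cis; simpl.
replace (cos t * (cos t * 1) + sin t * (sin t * 1)) with 1; [apply sqrt_1|].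
pose proof (sin2_cos2 t); unfold Rsqr in *; lra.
Qed.

Lemma cis_plus (s t : R) : cis (s + t) = (cis s * cis t)%C.
Proof.
unfold cis; apply C_ext; simpl; [rewrite cos_plus | rewrite sin_plus]; ring.
Qed.

Lemma cis_pow (t : R) (n : nat) : (cis t ^ n)%C = cis (INR n * t).
Proof.
induction n as [|n IH].
- simpl; unfold cis; rewrite Rmult_0_l, cos_0, sin_0; reflexivity.
- rewrite Cpow_S, IH, <- cis_plus, S_INR; f_equal; ring.
Qed.

Lemma cis_opp (t : R) : (cis (- t) * cis t)%C = 1.
Proof.
rewrite <- cis_plus; unfold cis; replace (- t + t) with 0 by ring.
now rewrite cos_0, sin_0.
Qed.

Lemma cis_2PI : cis (2 * PI) = cis 0.
Proof. unfold cis; now rewrite cos_2PI, sin_2PI, cos_0, sin_0. Qed.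

Lemma Ccontinuous_cis (t : R) : Ccontinuous cis t.
Proof. split; simpl; [apply continuous_cos | apply continuous_sin]. Qed.

Definition mean (f : R -> C) : C := (/ RtoC (2 * PI) * CInt f 0 (2 * PI))%C.

Lemma two_PI_pos : 0 < 2 * PI.
Proof. pose proof PI_RGT_0; lra. Qed.

Lemma two_PI_neq_0 : RtoC (2 * PI) <> 0.
Proof. intros H; apply (f_equal Re) in H; simpl in H; pose proof two_PI_pos; lra. Qed.

Lemma mean_ext (f g : R -> C) : (forall t, f t = g t) -> mean f = mean g.
Proof.
intros H; unfold mean; f_equal; apply CInt_ext; [pose proof two_PI_pos; lra | intros; apply H].
Qed.

Lemma mean_plus (f g : R -> C) :
  (forall t, Ccontinuous f t) -> (forall t, Ccontinuous g t) ->
  mean (fun t => f t + g t)%C = (mean f + mean g)%C.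
Proof.
intros Hf Hg; unfold mean; rewrite CInt_plus; auto; [ring | pose proof two_PI_pos; lra].
Qed.

Lemma mean_scal (c : C) (f : R -> C) : (forall t, Ccontinuous f t) ->
  mean (fun t => c * f t)%C = (c * mean f)%C.
Proof.
intros Hf; unfold mean; rewrite CInt_scal; auto; [ring | pose proof two_PI_pos; lra].
Qed.

Lemma mean_const (c : C) : mean (fun _ => c) = c.
Proof.
unfold mean; rewrite CInt_const by (pose proof two_PI_pos; lra); rewrite Rminus_0_r.
field; apply two_PI_neq_0.
Qed.

Lemma mean_bound (f : R -> C) (M : R) : (forall t, Ccontinuous f t) ->
  (forall t, Cmod (f t) <= M) -> Cmod (mean f) <= M.
Proof.
intros Hf HM; pose proof two_PI_pos as H2.
unfold mean; rewrite Cmod_mult, Cmod_inv by apply two_PI_neq_0.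
rewrite Cmod_R, Rabs_right by lra.
apply Rmult_le_reg_l with (2 * PI); [lra|].
rewrite <- Rmult_assoc, Rinv_r, Rmult_1_l by lra.
replace (2 * PI * M) with ((2 * PI - 0) * M) by ring.
apply CInt_bound; auto; lra.
Qed.

(** For [j <> k] the integrand has an antiderivative that takes the same value at
0 and [2 * PI]. *)
Lemma mean_cis (j k : nat) :
  mean (fun t => cis ((INR j - INR k) * t)) = if Nat.eqb j k then 1 else 0.
Proof.
destruct (Nat.eqb_spec j k) as [->|Hjk].
- rewrite (mean_ext _ (fun _ => 1)); [apply mean_const|].
  intros t; rewrite Rminus_diag, Rmult_0_l; unfold cis; now rewrite cos_0, sin_0.
- set (m := INR j - INR k).
  assert (Hm : m <> 0).
  { intros H; apply Hjk, INR_eq; unfold m in H; lra. }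
  unfold mean.
  rewrite (CInt_derive (fun t => (sin (m * t) / m, - cos (m * t) / m))).
  + assert (E : cis (m * (2 * PI)) = cis 0).
    { unfold m; rewrite Rmult_minus_distr_r; unfold Rminus; rewrite cis_plus.
      assert (P : forall n, cis (INR n * (2 * PI)) = cis 0).
      { intros n; rewrite <- cis_pow, cis_2PI, cis_pow; f_equal; ring. }
      assert (P0 : forall u, cis u = cis 0 -> cis (- u) = cis 0).
      { unfold cis; intros u Hu; rewrite cos_neg, sin_neg, cos_0, sin_0 in *.
        injection Hu as -> ->; f_equal; ring. }
      rewrite P, P0 by apply P; rewrite <- cis_plus; f_equal; ring. }
    unfold cis in E; injection E as E1 E2.
    rewrite E1, E2, Rmult_0_r.
    apply C_ext; simpl; field; assumption || (pose proof two_PI_pos; lra).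
  + pose proof two_PI_pos; lra.
  + intros t; simpl; auto_derive; [trivial | field; exact Hm].
  + intros t; simpl; auto_derive; [trivial | field; exact Hm].
  + intros t; split; simpl.
    * apply continuous_comp; [|apply continuous_cos].
      apply (continuous_mult (K := R_AbsRing)); [apply continuous_const | apply continuous_id].
    * apply continuous_comp; [|apply continuous_sin].
      apply (continuous_mult (K := R_AbsRing)); [apply continuous_const | apply continuous_id].
Qed.

(** * Goursat's theorem and homotopy of loops *)

Lemma entire_expansion (f : C -> C) (z : C) : entire f ->
  exists l : C, forall e, 0 < e -> exists d, 0 < d /\
    forall z', Cmod (z' - z) < d ->
      Cmod (f z' - f z - l * (z' - z)) <= e * Cmod (z' - z).
Proof.
intros Hf; destruct (Hf z) as [l [_ Hl]]; exists l; intros e He.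
destruct (Hl z (fun P HP => HP) (mkposreal e He)) as [d Hd].
exists d; split; [apply cond_pos|]; intros z' Hz'.
specialize (Hd z' Hz').
replace (f z' - f z - l * (z' - z))%C with (f z' - f z - (z' - z) * l)%C by ring.
exact Hd.
Qed.

Lemma entire_continuous (f : C -> C) (z : C) : entire f ->
  forall e, 0 < e -> exists d, 0 < d /\
    forall z', Cmod (z' - z) < d -> Cmod (f z' - f z) < e.
Proof.
intros Hf e He; destruct (entire_expansion f z Hf) as [l Hl].
destruct (Hl 1 Rlt_0_1) as [d [Hd H]].
pose proof (Cmod_ge_0 l) as Hl0.
assert (Hq : 0 < e / (Cmod l + 1)) by (apply Rdiv_lt_0_compat; lra).
exists (Rmin d (e / (Cmod l + 1))); split; [now apply Rmin_glb_lt|].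
intros z' Hz'.
pose proof (Rmin_l d (e / (Cmod l + 1))); pose proof (Rmin_r d (e / (Cmod l + 1))).
specialize (H z' ltac:(lra)).
replace (f z' - f z)%C with ((f z' - f z - l * (z' - z)) + l * (z' - z))%C by ring.
eapply Rle_lt_trans; [apply Cmod_triangle|]; rewrite Cmod_mult.
apply Rle_lt_trans with ((Cmod l + 1) * Cmod (z' - z)); [lra|].
apply Rlt_le_trans with ((Cmod l + 1) * (e / (Cmod l + 1))).
- apply Rmult_lt_compat_l; lra.
- right; field; lra.
Qed.

Lemma Ccontinuous_comp_entire (f : C -> C) (p : R -> C) (t : R) :
  entire f -> Ccontinuous p t -> Ccontinuous (fun u => f (p u)) t.
Proof.
rewrite !Ccontinuous_eps; intros Hf Hp e He.
destruct (entire_continuous f (p t) Hf e He) as [d [Hd H]].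
destruct (Hp d Hd) as [d' [Hd' H']].
exists d'; split; [exact Hd'|]; intros u Hu; apply H, H', Hu.
Qed.

Lemma nested_intervals (a b : nat -> R) :
  (forall k, a k <= a (S k)) -> (forall k, b (S k) <= b k) ->
  (forall k, a k <= b k) -> exists p, forall k, a k <= p <= b k.
Proof.
intros Ha Hb Hab.
assert (Ma : forall j k, (j <= k)%nat -> a j <= a k).
{ intros j k H; induction H; [lra | specialize (Ha m); lra]. }
assert (Mb : forall j k, (j <= k)%nat -> b k <= b j).
{ intros j k H; induction H; [lra | specialize (Hb m); lra]. }
assert (H : forall j k, a j <= b k).
{ intros j k; specialize (Ma j (max j k) ltac:(lia)).
  specialize (Mb k (max j k) ltac:(lia)); specialize (Hab (max j k)); lra. }
destruct (completeness (fun x => exists k, x = a k)) as [p [Hp1 Hp2]].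
- exists (b 0%nat); intros x [k ->]; apply H.
- now exists (a 0%nat), 0%nat.
- exists p; intros k; split; [apply Hp1; now exists k|].
  apply Hp2; intros x [j ->]; apply H.
Qed.

(** Goursat's argument in abstract form.  If [nu] were positive on the large
rectangle, one of its four quarters would carry at least a quarter of the value,
and so on; after [k] steps the value is at least [4 ^ (- k)] times the initial
one, on a rectangle whose squared size is also of order [4 ^ (- k)].  This
contradicts the local hypothesis at the point common to all these rectangles. *)
Lemma rectangle_bisection (nu : R -> R -> R -> R -> R) (s0 s1 t0 t1 : R) :
  s0 <= s1 -> t0 <= t1 ->
  (forall a b c d, s0 <= a -> a <= b -> b <= s1 -> t0 <= c -> c <= d -> d <= t1 ->
     nu a b c d <= nu a ((a + b) / 2) c ((c + d) / 2) + nu ((a + b) / 2) b c ((c + d) / 2)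
                 + nu a ((a + b) / 2) ((c + d) / 2) d + nu ((a + b) / 2) b ((c + d) / 2) d) ->
  (forall p q, s0 <= p <= s1 -> t0 <= q <= t1 -> forall e, 0 < e ->
     exists r, 0 < r /\ forall a b c d,
       s0 <= a -> a <= p <= b -> b <= s1 -> t0 <= c -> c <= q <= d -> d <= t1 ->
       (b - a) + (d - c) < r -> nu a b c d <= e * ((b - a) + (d - c)) ^ 2) ->
  nu s0 s1 t0 t1 <= 0.
Proof.
intros Hs Ht Hsub Hloc.
destruct (Rle_or_lt (nu s0 s1 t0 t1) 0) as [|HV]; [assumption|exfalso].
set (V := nu s0 s1 t0 t1) in *.
set (size := (s1 - s0) + (t1 - t0)).
set (val := fun Q : R * R * R * R => let '(a, b, c, d) := Q in nu a b c d).
set (step := fun Q : R * R * R * R => let '(a, b, c, d) := Q in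
  let m := (a + b) / 2 in let n := (c + d) / 2 in
  if Rle_dec (nu a b c d / 4) (nu a m c n) then (a, m, c, n) else
  if Rle_dec (nu a b c d / 4) (nu m b c n) then (m, b, c, n) else
  if Rle_dec (nu a b c d / 4) (nu a m n d) then (a, m, n, d) else (m, b, n, d)).
set (Q := fun k => Nat.iter k step (s0, s1, t0, t1)).
set (sl := fun k => fst (fst (fst (Q k)))); set (sr := fun k => snd (fst (fst (Q k)))).
set (tl := fun k => snd (fst (Q k))); set (tr := fun k => snd (Q k)).
assert (inv : forall k, s0 <= sl k /\ sl k <= sr k /\ sr k <= s1 /\
                        t0 <= tl k /\ tl k <= tr k /\ tr k <= t1 /\
                        (sr k - sl k) + (tr k - tl k) = size * (1 / 2) ^ k /\
                        V * (1 / 4) ^ k <= nu (sl k) (sr k) (tl k) (tr k) /\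
                        sl k <= sl (S k) /\ sr (S k) <= sr k /\ tl k <= tl (S k) /\ tr (S k) <= tr k).
{ intros k.
  assert (mono : s0 <= sl k /\ sl k <= sr k /\ sr k <= s1 /\
                        t0 <= tl k /\ tl k <= tr k /\ tr k <= t1 ->
     sl k <= sl (S k) /\ sr (S k) <= sr k /\ tl k <= tl (S k) /\ tr (S k) <= tr k /\
     sl (S k) <= sr (S k) /\ tl (S k) <= tr (S k) /\
     sr (S k) - sl (S k) = (sr k - sl k) / 2 /\ tr (S k) - tl (S k) = (tr k - tl k) / 2 /\
     nu (sl k) (sr k) (tl k) (tr k) / 4 <= nu (sl (S k)) (sr (S k)) (tl (S k)) (tr (S k))).
  { unfold sl, sr, tl, tr; change (Q (S k)) with (step (Q k)).
    destruct (Q k) as [[[a b] c] d]; cbn [fst snd]; intros H.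
    specialize (Hsub a b c d ltac:(lra) ltac:(lra) ltac:(lra) ltac:(lra) ltac:(lra) ltac:(lra)).
    unfold step; repeat destruct Rle_dec; cbn [fst snd]; repeat split; lra. }
  enough (s0 <= sl k /\ sl k <= sr k /\ sr k <= s1 /\
                        t0 <= tl k /\ tl k <= tr k /\ tr k <= t1 /\
                        (sr k - sl k) + (tr k - tl k) = size * (1 / 2) ^ k /\
                        V * (1 / 4) ^ k <= nu (sl k) (sr k) (tl k) (tr k)) by (repeat split; tauto).
  clear mono; induction k as [|k IH].
  - unfold sl, sr, tl, tr; simpl; fold V; unfold size; repeat split; lra.
  - revert IH; unfold sl, sr, tl, tr; change (Q (S k)) with (step (Q k)).
    destruct (Q k) as [[[a b] c] d]; cbn [fst snd pow]; intros H.
    specialize (Hsub a b c d ltac:(lra) ltac:(lra) ltac:(lra) ltac:(lra) ltac:(lra) ltac:(lra)).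
    unfold step; repeat destruct Rle_dec; cbn [fst snd]; repeat split; lra. }
destruct (nested_intervals sl sr) as [p Hp]; try (intros k; apply (inv k)).
destruct (nested_intervals tl tr) as [q Hq]; try (intros k; apply (inv k)).
assert (He : 0 < V / (size ^ 2 + 1)) by (apply Rdiv_lt_0_compat; nra).
destruct (Hloc p q) with (e := V / (size ^ 2 + 1)) as [r [Hr Hloc']]; try exact He.
{ exact (Hp 0%nat). }
{ exact (Hq 0%nat). }
assert (Hsize : 0 <= size) by (unfold size; lra).
destruct (pow_lt_1_zero (1 / 2)) with (y := r / (size + 1)) as [k Hk].
{ rewrite Rabs_right; lra. }
{ apply Rdiv_lt_0_compat; lra. }
specialize (Hk k (le_n k)); rewrite Rabs_right in Hk by (apply Rle_ge, pow_le; lra).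
specialize (Hp k); specialize (Hq k).
destruct (inv k) as (H1 & H2 & H3 & H4 & H5 & H6 & H7 & H8 & _).
assert (Hpow : 0 < (1 / 2) ^ k) by (apply pow_lt; lra).
assert (Hsmall : size * (1 / 2) ^ k < r).
{ apply Rle_lt_trans with ((size + 1) * (1 / 2) ^ k); [nra|].
  apply Rmult_lt_compat_l with (r := size + 1) in Hk; [|lra].
  replace ((size + 1) * (r / (size + 1))) with r in Hk by (field; lra); exact Hk. }
assert (Hc := Hloc' (sl k) (sr k) (tl k) (tr k) H1 Hp H3 H4 Hq H6 ltac:(rewrite H7; exact Hsmall)).
rewrite H7 in Hc.
replace ((size * (1 / 2) ^ k) ^ 2) with (size ^ 2 * (1 / 4) ^ k) in Hc
  by (replace (1 / 4) with ((1 / 2) * (1 / 2)) by lra; rewrite !Rpow_mult_distr; ring).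
assert (Hpow4 : 0 < (1 / 4) ^ k) by (apply pow_lt; lra).
assert (V / (size ^ 2 + 1) * (size ^ 2 * (1 / 4) ^ k) < V * (1 / 4) ^ k); [|lra].
rewrite <- Rmult_assoc; apply Rmult_lt_compat_r; [exact Hpow4|].
apply Rmult_lt_reg_r with (size ^ 2 + 1); [nra|].
field_simplify; nra.
Qed.

(** The loop is [w + v t] for [t] in [[0, T]], and [Phi s t] scales it about [w] by
the factor [s].  [kappa] is the logarithmic derivative [dv / v], so that
[f (Phi s t) * kappa t] integrates [f z / (z - w)] along the loop of parameter [s]
and [f (Phi s t) / s] integrates it along the ray of parameter [t]; [boundary] is
then its integral around the image of the rectangle [[a, b]] by [[c, d]].  Staying
above [s0 > 0] keeps away from the pole [w]. *)
Section ScaledLoop.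

Variables (f : C -> C) (w : C) (v dv kappa : R -> C) (T V K s0 s1 : R).
Hypothesis f_entire : entire f.
Hypothesis T_pos : 0 <= T.
Hypothesis v_derive_Re : forall t, is_derive (fun u => Re (v u)) t (Re (dv t)).
Hypothesis v_derive_Im : forall t, is_derive (fun u => Im (v u)) t (Im (dv t)).
Hypothesis dv_continuous : forall t, Ccontinuous dv t.
Hypothesis kappa_continuous : forall t, Ccontinuous kappa t.
Hypothesis kappa_v : forall t, (kappa t * v t)%C = dv t.
Hypothesis v_bound : forall t, Cmod (v t) <= V.
Hypothesis kappa_bound : forall t, Cmod (kappa t) <= K.
Hypothesis s0_pos : 0 < s0.
Hypothesis s01 : s0 <= s1.

Let Phi (s t : R) : C := (w + RtoC s * v t)%C.
Let along_loop (s a b : R) : C := CInt (fun t => f (Phi s t) * kappa t)%C a b.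
Let along_ray (t a b : R) : C := CInt (fun s => f (Phi s t) * RtoC (/ s))%C a b.
Let boundary (a b c d : R) : C :=
  (along_loop b c d - along_loop a c d - (along_ray d a b - along_ray c a b))%C.

Lemma v_continuous (t : R) : Ccontinuous v t.
Proof.
split; apply (ex_derive_continuous (V := R_NormedModule));
  eexists; [apply v_derive_Re | apply v_derive_Im].
Qed.

Lemma V_nonneg : 0 <= V.
Proof. eapply Rle_trans; [apply Cmod_ge_0 | apply (v_bound 0)]. Qed.

Lemma K_nonneg : 0 <= K.
Proof. eapply Rle_trans; [apply Cmod_ge_0 | apply (kappa_bound 0)]. Qed.

Lemma CInt_dv (a b : R) : a <= b -> CInt dv a b = (v b - v a)%C.
Proof. intros Hab; now apply CInt_derive. Qed.

Lemma v_Lipschitz (a b : R) : Cmod (v b - v a) <= K * V * Rabs (b - a).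
Proof.
assert (H : forall a b, a <= b -> Cmod (v b - v a) <= K * V * Rabs (b - a)).
{ clear a b; intros a b Hab; rewrite <- CInt_dv by exact Hab.
  rewrite Rabs_right, Rmult_comm by lra; apply CInt_bound; auto.
  intros t _; rewrite <- kappa_v, Cmod_mult.
  apply Rmult_le_compat; auto using Cmod_ge_0. }
destruct (Rle_or_lt a b) as [Hab|Hab]; [now apply H|].
rewrite Cmod_minus_sym, Rabs_minus_sym; apply H; lra.
Qed.

Lemma Phi_continuous_t (s t : R) : Ccontinuous (Phi s) t.
Proof.
apply Ccontinuous_plus; [apply Ccontinuous_const|].
apply Ccontinuous_mult; [apply Ccontinuous_const | apply v_continuous].
Qed.

Lemma Phi_continuous_s (s t : R) : Ccontinuous (fun s => Phi s t) s.
Proof.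
apply Ccontinuous_plus; [apply Ccontinuous_const|].
apply Ccontinuous_mult; [|apply Ccontinuous_const].
apply Ccontinuous_RtoC, continuous_id.
Qed.

Lemma loop_integrand_continuous (g : C -> C) (s t : R) :
  entire g -> Ccontinuous (fun t => g (Phi s t) * kappa t)%C t.
Proof.
intros Hg; apply Ccontinuous_mult; [|apply kappa_continuous].
apply (Ccontinuous_comp_entire g (Phi s)); [exact Hg | apply Phi_continuous_t].
Qed.

Lemma ray_integrand_continuous (g : C -> C) (s t : R) : 0 < s ->
  entire g -> Ccontinuous (fun s => g (Phi s t) * RtoC (/ s))%C s.
Proof.
intros Hs Hg; apply Ccontinuous_mult.
- apply (Ccontinuous_comp_entire g (fun s => Phi s t)); [exact Hg | apply Phi_continuous_s].
- apply Ccontinuous_RtoC, continuous_Rinv; lra.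
Qed.

Lemma boundary_subadditive (a b c d : R) :
  s0 <= a -> a <= b -> c <= d ->
  let m := (a + b) / 2 in let n := (c + d) / 2 in
  Cmod (boundary a b c d) <= Cmod (boundary a m c n) + Cmod (boundary m b c n)
                           + Cmod (boundary a m n d) + Cmod (boundary m b n d).
Proof.
intros Ha Hab Hcd m n.
assert (L : forall s, (along_loop s c n + along_loop s n d)%C = along_loop s c d).
{ intros s; apply CInt_Chasles; unfold n; try lra.
  intros t _; now apply loop_integrand_continuous. }
assert (Y : forall t, (along_ray t a m + along_ray t m b)%C = along_ray t a b).
{ intros t; apply CInt_Chasles; unfold m; try lra.
  intros s Hs; apply ray_integrand_continuous; [lra | assumption]. }
replace (boundary a b c d) with
  (boundary a m c n + boundary m b c n + boundary a m n d + boundary m b n d)%C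
  by (unfold boundary; rewrite <- (L a), <- (L b), <- (Y c), <- (Y d); ring).
eapply Rle_trans; [apply Cmod_triangle|]; apply Rplus_le_compat_r.
eapply Rle_trans; [apply Cmod_triangle|]; apply Rplus_le_compat_r.
apply Cmod_triangle.
Qed.

(** Near [z0 = Phi p q], write [f] as an affine function plus an error [g].  The
affine part contributes nothing to [boundary], since its two loop integrals and
its two ray integrals have the same difference [l (b - a) (v d - v c)].  The error
is at most a small multiple of the size of the rectangle, and so is its integral
along a side divided by the length of the side. *)
Lemma boundary_local (p q : R) : s0 <= p <= s1 -> forall e, 0 < e ->
  exists r, 0 < r /\ forall a b c d,
    s0 <= a -> a <= p <= b -> b <= s1 -> c <= q <= d -> (b - a) + (d - c) < r ->
    Cmod (boundary a b c d) <= e * ((b - a) + (d - c)) ^ 2.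
Proof.
intros Hp e He.
pose proof V_nonneg as HV; pose proof K_nonneg as HK.
set (z0 := Phi p q).
destruct (entire_expansion f z0 f_entire) as [l Hl].
(* [M] is a Lipschitz constant of [Phi] on the strip [s0 <= s <= s1]. *)
set (M := V + s1 * (K * V)).
assert (HM : 0 <= M) by (unfold M; assert (0 <= K * V) by nra; nra).
assert (Hs0 : 0 < / s0) by (now apply Rinv_0_lt_compat).
set (N := 2 * M * (K + / s0) + 1).
assert (HN : 0 < N) by (unfold N; assert (0 <= M * (K + / s0)) by nra; nra).
destruct (Hl (e / N)) as [d' [Hd' Hexp]]; [now apply Rdiv_lt_0_compat|].
exists (d' / (M + 1)); split; [apply Rdiv_lt_0_compat; lra|].
intros a b c d Ha Hab Hb Hcd Hsize.
set (size := (b - a) + (d - c)) in *.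
assert (Hsize0 : 0 <= size) by (unfold size; lra).
assert (HMsize : M * size < d').
{ apply Rle_lt_trans with ((M + 1) * size); [nra|].
  apply Rmult_lt_compat_l with (r := M + 1) in Hsize; [|lra].
  replace ((M + 1) * (d' / (M + 1))) with d' in Hsize by (field; lra); exact Hsize. }
assert (near : forall s t, a <= s <= b -> c <= t <= d -> Cmod (Phi s t - z0) <= M * size).
{ intros s t Hs Ht.
  replace (Phi s t - z0)%C with (RtoC (s - p) * v t + RtoC p * (v t - v q))%C
    by (unfold z0, Phi; rewrite RtoC_minus; ring).
  eapply Rle_trans; [apply Cmod_triangle|]; rewrite !Cmod_mult, !Cmod_R.
  rewrite (Rabs_right p) by lra.
  assert (H1 : Rabs (s - p) <= size) by (apply Rabs_le; unfold size; lra).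
  assert (H2 : Rabs (t - q) <= size) by (apply Rabs_le; unfold size; lra).
  pose proof (v_Lipschitz q t) as H3; pose proof (v_bound t) as H4.
  assert (HKV : 0 <= K * V) by nra.
  pose proof (Rabs_pos (s - p)); pose proof (Cmod_ge_0 (v t)); pose proof (Cmod_ge_0 (v t - v q)).
  assert (Cmod (v t - v q) <= K * V * size) by nra.
  unfold M; replace ((V + s1 * (K * V)) * size) with (size * V + s1 * (K * V * size)) by ring.
  apply Rplus_le_compat; apply Rmult_le_compat; lra. }
set (g := fun z => (f z - f z0 - l * (z - z0))%C).
assert (small : forall s t, a <= s <= b -> c <= t <= d -> Cmod (g (Phi s t)) <= e / N * (M * size)).
{ intros s t Hs Ht; pose proof (near s t Hs Ht) as Hn.
  eapply Rle_trans; [apply Hexp; lra|].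
  apply Rmult_le_compat_l; [|exact Hn]; apply Rlt_le, Rdiv_lt_0_compat; lra. }
set (eta := e / N * (M * size)) in *.
assert (small2 : forall s t s' t', a <= s <= b -> c <= t <= d -> a <= s' <= b -> c <= t' <= d ->
  Cmod (g (Phi s t) - g (Phi s' t')) <= 2 * eta).
{ intros s t s' t' Hs Ht Hs' Ht'.
  pose proof (small s t Hs Ht); pose proof (small s' t' Hs' Ht').
  unfold Cminus; eapply Rle_trans; [apply Cmod_triangle|]; rewrite Cmod_opp; lra. }
assert (gcont : forall s t, Ccontinuous (fun t => g (Phi s t)) t).
{ intros s t; unfold g; apply Ccontinuous_minus.
  - apply Ccontinuous_minus; [|apply Ccontinuous_const].
    apply (Ccontinuous_comp_entire f (Phi s)); [exact f_entire | apply Phi_continuous_t].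
  - apply Ccontinuous_mult; [apply Ccontinuous_const|].
    apply Ccontinuous_minus; [apply Phi_continuous_t | apply Ccontinuous_const]. }
assert (gcont' : forall s t, Ccontinuous (fun s => g (Phi s t)) s).
{ intros s t; unfold g; apply Ccontinuous_minus.
  - apply Ccontinuous_minus; [|apply Ccontinuous_const].
    apply (Ccontinuous_comp_entire f (fun s => Phi s t)); [exact f_entire | apply Phi_continuous_s].
  - apply Ccontinuous_mult; [apply Ccontinuous_const|].
    apply Ccontinuous_minus; [apply Phi_continuous_s | apply Ccontinuous_const]. }
assert (EL : (along_loop b c d - along_loop a c d)%C =
  (CInt (fun t => (g (Phi b t) - g (Phi a t)) * kappa t) c d
   + l * RtoC (b - a) * (v d - v c))%C).
{ unfold along_loop; rewrite <- CInt_minus; try lra;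
    try (intros; now apply loop_integrand_continuous).
  rewrite <- CInt_dv, <- CInt_scal, <- CInt_plus; try lra; auto.
  - apply CInt_ext; [lra|]; intros t _; rewrite <- kappa_v; unfold g, Phi.
    rewrite RtoC_minus; ring.
  - intros t _; apply Ccontinuous_mult; auto; apply Ccontinuous_minus; auto.
  - intros t _; apply Ccontinuous_mult; [apply Ccontinuous_const | auto]. }
assert (ER : (along_ray d a b - along_ray c a b)%C =
  (CInt (fun s => (g (Phi s d) - g (Phi s c)) * RtoC (/ s)) a b
   + l * RtoC (b - a) * (v d - v c))%C).
{ unfold along_ray; rewrite <- CInt_minus; try lra;
    try (intros; apply ray_integrand_continuous; [lra | assumption]).
  replace (l * RtoC (b - a) * (v d - v c))%C with (RtoC (b - a) * (l * (v d - v c)))%C by ring.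
  rewrite <- CInt_const, <- CInt_plus; try lra; auto.
  - apply CInt_ext; [lra|]; intros s Hs; unfold g, Phi.
    rewrite RtoC_inv by lra; field; intros H; apply (f_equal Re) in H; simpl in H; lra.
  - intros s Hs; apply Ccontinuous_mult; [apply Ccontinuous_minus; auto|].
    apply Ccontinuous_RtoC, continuous_Rinv; lra.
  - intros; apply Ccontinuous_const. }
unfold boundary; rewrite EL, ER.
match goal with |- Cmod (?x + ?z - (?y + ?z)) <= _ =>
  replace (x + z - (y + z))%C with (x + - y)%C by ring end.
eapply Rle_trans; [apply Cmod_triangle|]; rewrite Cmod_opp.
assert (B1 : Cmod (CInt (fun t => (g (Phi b t) - g (Phi a t)) * kappa t)%C c d)
             <= (d - c) * (2 * eta * K)).
{ apply CInt_bound; [lra| |].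
  - intros t _; apply Ccontinuous_mult; auto; apply Ccontinuous_minus; auto.
  - intros t Ht; rewrite Cmod_mult; apply Rmult_le_compat; auto using Cmod_ge_0.
    apply small2; lra. }
assert (B2 : Cmod (CInt (fun s => (g (Phi s d) - g (Phi s c)) * RtoC (/ s))%C a b)
             <= (b - a) * (2 * eta * / s0)).
{ apply CInt_bound; [lra| |].
  - intros s Hs; apply Ccontinuous_mult; [apply Ccontinuous_minus; auto|].
    apply Ccontinuous_RtoC, continuous_Rinv; lra.
  - intros s Hs; rewrite Cmod_mult; apply Rmult_le_compat; auto using Cmod_ge_0.
    + apply small2; lra.
    + rewrite Cmod_R, Rabs_right; [apply Rinv_le_contravar; lra|].
      apply Rle_ge, Rlt_le, Rinv_0_lt_compat; lra. }
assert (Heta : 0 <= eta).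
{ unfold eta; apply Rmult_le_pos; [apply Rlt_le, Rdiv_lt_0_compat; lra | nra]. }
apply Rle_trans with (size * (2 * eta * (K + / s0))).
- assert (0 <= (b - a) * (eta * K)) by (apply Rmult_le_pos; [lra | apply Rmult_le_pos; lra]).
  assert (0 <= (d - c) * (eta * / s0)) by (apply Rmult_le_pos; [lra | apply Rmult_le_pos; lra]).
  eapply Rle_trans; [apply Rplus_le_compat; [exact B1 | exact B2]|].
  unfold size; clearbody eta; lra.
- replace (size * (2 * eta * (K + / s0))) with (e / N * size ^ 2 * (2 * M * (K + / s0)))
    by (unfold eta; ring).
  replace (2 * M * (K + / s0)) with (N - 1) by (unfold N; ring).
  replace (e / N * size ^ 2 * (N - 1)) with (e * size ^ 2 - e * size ^ 2 / N) by (field; lra).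
  assert (0 <= e * size ^ 2 / N); [|lra].
  apply Rmult_le_pos; [apply Rmult_le_pos; [lra | apply pow2_ge_0]|].
  apply Rlt_le, Rinv_0_lt_compat, HN.
Qed.

(** The rays at [t = 0] and [t = T] coincide because the loop is closed; their
contributions to [boundary] cancel and the two loop integrals remain. *)
Lemma loop_integral_invariant : v T = v 0 ->
  CInt (fun t => f (w + RtoC s0 * v t) * kappa t)%C 0 T =
  CInt (fun t => f (w + RtoC s1 * v t) * kappa t)%C 0 T.
Proof.
intros Hclosed.
assert (H0 : Cmod (boundary s0 s1 0 T) <= 0).
{ apply (rectangle_bisection (fun a b c d => Cmod (boundary a b c d))); auto.
  - intros a b c d H1 H2 _ _ H3 _; now apply boundary_subadditive.
  - intros p q Hp _ e He; destruct (boundary_local p q Hp e He) as [r [Hr H]].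
    exists r; split; [exact Hr|]; intros; now apply H. }
assert (H : boundary s0 s1 0 T = 0).
{ apply Cmod_eq_0, Rle_antisym; [exact H0 | apply Cmod_ge_0]. }
unfold boundary in H.
replace (along_ray T s0 s1) with (along_ray 0 s0 s1) in H
  by (unfold along_ray, Phi; now rewrite Hclosed).
change (along_loop s0 0 T = along_loop s1 0 T).
replace (along_loop s1 0 T) with
  (along_loop s1 0 T - along_loop s0 0 T - (along_ray 0 s0 s1 - along_ray 0 s0 s1)
   + along_loop s0 0 T)%C by ring.
rewrite H; ring.
Qed.

End ScaledLoop.

(** * Polynomials on the disk and their coefficients *)

Fixpoint poly_sum (a : nat -> C) (n : nat) (z : C) : C :=
  match n with
  | O => 0
  | S n => (poly_sum a n z + a n * z ^ n)%C
  end.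

Lemma poly_sum_ext (a b : nat -> C) (n : nat) (z : C) :
  (forall k, (k < n)%nat -> a k = b k) -> poly_sum a n z = poly_sum b n z.
Proof.
induction n as [|n IH]; intros H; [reflexivity|]; simpl.
rewrite IH, (H n) by (intros; try apply H; lia); reflexivity.
Qed.

Lemma poly_sum_minus (a b : nat -> C) (n : nat) (z : C) :
  poly_sum (fun k => a k - b k)%C n z = (poly_sum a n z - poly_sum b n z)%C.
Proof. induction n as [|n IH]; simpl; [ring | rewrite IH; ring]. Qed.

(** Bernoulli's inequality, which gives the explicit limit of [r ^ k] as [r] tends to
1 in [poly_coef_bound]. *)
Lemma pow_one_minus_ge (x : R) (k : nat) : 0 <= x <= 1 -> 1 - INR k * x <= (1 - x) ^ k.
Proof.
intros Hx; induction k as [|k IH]; [simpl; lra|].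
rewrite S_INR, <- tech_pow_Rmult; pose proof (pos_INR k).
assert (0 <= INR k * (x * x)) by (apply Rmult_le_pos; nra); nra.
Qed.

Lemma Cpow_RtoC_cis (r t : R) (k : nat) :
  ((RtoC r * cis t) ^ k)%C = (RtoC (r ^ k) * cis (INR k * t))%C.
Proof. now rewrite Cpow_mult_l, cis_pow, RtoC_pow. Qed.

Lemma Ccontinuous_cis_scal (m t : R) : Ccontinuous (fun t => cis (m * t)) t.
Proof.
assert (H : continuous (fun t => m * t) t).
{ apply (continuous_mult (K := R_AbsRing)); [apply continuous_const | apply continuous_id]. }
split; simpl; apply continuous_comp; auto using continuous_cos, continuous_sin.
Qed.

Lemma poly_sum_continuous_circle (c : nat -> C) (n : nat) (r t : R) :
  Ccontinuous (fun t => poly_sum c n (RtoC r * cis t)) t.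
Proof.
induction n as [|n IH]; [apply Ccontinuous_const|].
apply Ccontinuous_plus; [exact IH|].
apply Ccontinuous_mult; [apply Ccontinuous_const|].
apply (Ccontinuous_pow (fun t => RtoC r * cis t)%C).
apply Ccontinuous_mult; [apply Ccontinuous_const | apply Ccontinuous_cis].
Qed.

Lemma mean_poly_sum (c : nat -> C) (n k : nat) (r : R) :
  mean (fun t => poly_sum c n (RtoC r * cis t) * cis (- INR k * t))%C =
  if Nat.ltb k n then (c k * RtoC (r ^ k))%C else 0.
Proof.
induction n as [|n IH]; cbn [poly_sum].
- rewrite (mean_ext _ (fun _ => 0)) by (intros; simpl; ring).
  rewrite mean_const; reflexivity.
- rewrite (mean_ext _ (fun t => poly_sum c n (RtoC r * cis t) * cis (- INR k * t)
    + (c n * RtoC (r ^ n)) * cis ((INR n - INR k) * t))%C).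
  2:{ intros t; rewrite Cpow_RtoC_cis.
      replace ((INR n - INR k) * t) with (INR n * t + - INR k * t) by ring.
      rewrite cis_plus; ring. }
  rewrite mean_plus, mean_scal, mean_cis, IH.
  + destruct (Nat.ltb_spec k n), (Nat.ltb_spec k (S n)), (Nat.eqb_spec n k);
      try lia; subst; ring.
  + intros t; apply Ccontinuous_cis_scal.
  + intros t; apply Ccontinuous_mult;
      [apply poly_sum_continuous_circle | apply Ccontinuous_cis_scal].
  + intros t; apply Ccontinuous_mult; [apply Ccontinuous_const | apply Ccontinuous_cis_scal].
Qed.

(** On the circle of radius [r < 1], the mean of the polynomial against
[cis (- k t)] is [c k * r ^ k]; then [r] tends to 1. *)
Lemma poly_coef_bound (c : nat -> C) (n k : nat) (delta : R) : (k < n)%nat ->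
  (forall z, Cmod z < 1 -> Cmod (poly_sum c n z) <= delta) -> Cmod (c k) <= delta.
Proof.
intros Hk Hd.
assert (H : forall r, 0 <= r < 1 -> Cmod (c k) * r ^ k <= delta).
{ intros r Hr.
  replace (Cmod (c k) * r ^ k) with (Cmod (c k * RtoC (r ^ k))).
  2:{ rewrite Cmod_mult, Cmod_R, Rabs_right; [reflexivity|].
      apply Rle_ge, pow_le; lra. }
  pose proof (mean_poly_sum c n k r) as E.
  destruct (Nat.ltb_spec k n); [|lia]; rewrite <- E.
  apply mean_bound.
  - intros t; apply Ccontinuous_mult;
      [apply poly_sum_continuous_circle | apply Ccontinuous_cis_scal].
  - intros t; rewrite Cmod_mult, Cmod_cis, Rmult_1_r; apply Hd.
    rewrite Cmod_mult, Cmod_cis, Cmod_R, Rabs_right; lra. }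
apply le_epsilon; intros e He.
pose proof (Cmod_ge_0 (c k)) as H0; pose proof (pos_INR k) as Hk0.
set (x := Rmin 1 (e / (Cmod (c k) * INR k + 1))).
assert (Hden : 0 < Cmod (c k) * INR k + 1) by nra.
assert (Hx : 0 < x <= 1).
{ unfold x; split; [apply Rmin_glb_lt; [lra | now apply Rdiv_lt_0_compat] | apply Rmin_l]. }
specialize (H (1 - x) ltac:(lra)).
pose proof (pow_one_minus_ge x k ltac:(lra)) as Hp.
assert (Hx2 : (Cmod (c k) * INR k + 1) * x <= e).
{ apply Rle_trans with ((Cmod (c k) * INR k + 1) * (e / (Cmod (c k) * INR k + 1))).
  - apply Rmult_le_compat_l; [lra | apply Rmin_r].
  - right; field; lra. }
assert (Cmod (c k) * (1 - INR k * x) <= Cmod (c k) * (1 - x) ^ k)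
  by (apply Rmult_le_compat_l; assumption).
nra.
Qed.

(** * Cauchy's formula and Taylor expansion *)

(** [q] is Cauchy's kernel [dz / (z - w)] on the circle [gamma], relative to
[2 * PI * Ci] times the normalised arc length; a radius of at least 2 bounds it by
2 in modulus for every [w] of the disk. *)
Section CircleIntegrals.

Variables (w : C) (r : R).
Hypothesis w_disk : Cmod w < 1.
Hypothesis r_ge_2 : 2 <= r.

Let gamma (t : R) : C := (RtoC r * cis t)%C.
Let q (t : R) : C := (gamma t / (gamma t - w))%C.

Lemma Cmod_gamma (t : R) : Cmod (gamma t) = r.
Proof. unfold gamma; rewrite Cmod_mult, Cmod_cis, Cmod_R, Rabs_right; lra. Qed.

Lemma gamma_neq_0 (t : R) : gamma t <> 0.
Proof. intros H; pose proof (Cmod_gamma t) as E; rewrite H, Cmod_0 in E; lra. Qed.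

Lemma gamma_minus_ge (t : R) : r / 2 <= Cmod (gamma t - w).
Proof.
pose proof (Cmod_triangle (gamma t - w) w) as H.
replace (gamma t - w + w)%C with (gamma t) in H by ring.
rewrite Cmod_gamma in H; lra.
Qed.

Lemma gamma_minus_neq_0 (t : R) : (gamma t - w)%C <> 0.
Proof. intros H; pose proof (gamma_minus_ge t) as E; rewrite H, Cmod_0 in E; lra. Qed.

Lemma q_bound (t : R) : Cmod (q t) <= 2.
Proof.
pose proof (gamma_minus_ge t) as H.
unfold q; rewrite Cmod_div, Cmod_gamma by apply gamma_minus_neq_0.
apply Rmult_le_reg_r with (Cmod (gamma t - w)); [lra|].
unfold Rdiv; rewrite Rmult_assoc, Rinv_l by lra; lra.
Qed.

Lemma gamma_continuous (t : R) : Ccontinuous gamma t.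
Proof. apply Ccontinuous_mult; [apply Ccontinuous_const | apply Ccontinuous_cis]. Qed.

Lemma q_continuous (t : R) : Ccontinuous q t.
Proof.
apply Ccontinuous_mult; [apply gamma_continuous|].
apply (Ccontinuous_inv (fun t => gamma t - w)%C); [apply gamma_minus_neq_0|].
apply Ccontinuous_minus; [apply gamma_continuous | apply Ccontinuous_const].
Qed.

Lemma gamma_inv_pow_continuous (n : nat) (t : R) : Ccontinuous (fun t => (/ gamma t) ^ n)%C t.
Proof.
apply (Ccontinuous_pow (fun t => / gamma t)%C).
apply Ccontinuous_inv; [apply gamma_neq_0 | apply gamma_continuous].
Qed.

Lemma Cmod_gamma_inv_pow (n : nat) (t : R) : Cmod ((/ gamma t) ^ n) = / r ^ n.
Proof. rewrite Cmod_pow, Cmod_inv, Cmod_gamma by apply gamma_neq_0; apply pow_inv. Qed.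

(** Iteration of [q = 1 + (w / gamma) q]. *)
Lemma geometric_expansion (g : R -> C) (n : nat) : (forall t, Ccontinuous g t) ->
  mean (fun t => g t * q t)%C =
  (poly_sum (fun k => mean (fun t => g t * (/ gamma t) ^ k)%C) n w
   + w ^ n * mean (fun t => g t * ((/ gamma t) ^ n * q t))%C)%C.
Proof.
intros Hg.
assert (Hq : forall m t, Ccontinuous (fun t => (g t * ((/ gamma t) ^ m * q t))%C) t).
{ intros m t; apply Ccontinuous_mult; [apply Hg|].
  apply Ccontinuous_mult; [apply gamma_inv_pow_continuous | apply q_continuous]. }
induction n as [|n IH].
- simpl; rewrite (mean_ext _ (fun t => g t * (1 * q t))%C) by (intros; ring); ring.
- rewrite IH; cbn [poly_sum].
  rewrite (mean_ext (fun t => g t * ((/ gamma t) ^ n * q t))%C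
    (fun t => g t * (/ gamma t) ^ n + w * (g t * ((/ gamma t) ^ (S n) * q t)))%C).
  + rewrite mean_plus, mean_scal, Cpow_S; auto.
    * ring.
    * intros t; apply Ccontinuous_mult; [apply Hg | apply gamma_inv_pow_continuous].
    * intros t; apply Ccontinuous_mult; [apply Ccontinuous_const | apply Hq].
  + intros t; rewrite Cpow_S; unfold q; field.
    split; [apply gamma_minus_neq_0 | apply gamma_neq_0].
Qed.

Lemma remainder_bound (g : R -> C) (M : R) (n : nat) : (forall t, Ccontinuous g t) ->
  (forall t, Cmod (g t) <= M) ->
  Cmod (w ^ n * mean (fun t => g t * ((/ gamma t) ^ n * q t)))%C <= 2 * M / r ^ n.
Proof.
intros Hg HM; rewrite Cmod_mult, Cmod_pow.
assert (Hr : 0 < / r ^ n) by (apply Rinv_0_lt_compat, pow_lt; lra).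
rewrite <- (Rmult_1_l (2 * M / r ^ n)).
apply Rmult_le_compat; [apply pow_le, Cmod_ge_0 | apply Cmod_ge_0 | |].
- rewrite <- (pow1 n); apply pow_incr; split; [apply Cmod_ge_0 | lra].
- apply mean_bound.
  + intros t; apply Ccontinuous_mult; [apply Hg|].
    apply Ccontinuous_mult; [apply gamma_inv_pow_continuous | apply q_continuous].
  + intros t; rewrite !Cmod_mult, Cmod_gamma_inv_pow.
    replace (2 * M / r ^ n) with (M * (/ r ^ n * 2)) by (unfold Rdiv; ring).
    pose proof (q_bound t); pose proof (Cmod_ge_0 (q t)).
    apply Rmult_le_compat; auto using Cmod_ge_0.
    * apply Rmult_le_pos; lra.
    * apply Rmult_le_compat_l; lra.
Qed.

(** In the expansion of [mean q] only the constant term has a nonzero mean, and the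
remainders tend to 0. *)
Lemma mean_q : mean q = 1.
Proof.
assert (Hone : forall t, Ccontinuous (fun _ => 1 : C) t) by (intros; apply Ccontinuous_const).
assert (E : mean q = mean (fun t => 1 * q t)%C) by (apply mean_ext; intros; ring).
assert (P : forall n, poly_sum (fun k => mean (fun t => 1 * (/ gamma t) ^ k)%C) (S n) w = 1).
{ assert (Hc : forall k, mean (fun t => 1 * (/ gamma t) ^ k)%C = if Nat.eqb 0 k then 1 else 0).
  { intros k; rewrite (mean_ext _ (fun t => RtoC (/ r ^ k) * cis ((INR 0 - INR k) * t))%C).
    - rewrite mean_scal, mean_cis by (intros; apply Ccontinuous_cis_scal).
      destruct k; simpl; [rewrite Rinv_1|]; ring.
    - intros t; rewrite Cpow_inv by apply gamma_neq_0; unfold gamma; rewrite Cpow_RtoC_cis.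
      assert (Hr : RtoC (r ^ k) <> 0).
      { intros H; apply (f_equal Re) in H; simpl in H.
        pose proof (pow_lt r k ltac:(lra)); lra. }
      assert (Hcis : cis (INR k * t) <> 0).
      { intros H; pose proof (Cmod_cis (INR k * t)) as H1; rewrite H, Cmod_0 in H1; lra. }
      replace ((INR 0 - INR k) * t) with (- (INR k * t)) by (simpl; ring).
      rewrite <- (cis_opp (INR k * t)), RtoC_inv by (pose proof (pow_lt r k ltac:(lra)); lra).
      field; auto. }
  intros n; induction n as [|n IH].
  - cbn [poly_sum]; rewrite Hc; simpl; ring.
  - change (poly_sum (fun k => mean (fun t => 1 * (/ gamma t) ^ k)%C) (S n) w
      + mean (fun t => 1 * (/ gamma t) ^ (S n)) * w ^ (S n) = 1)%C.
    rewrite IH, Hc; simpl; ring. }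
assert (B : forall n, Cmod (mean q - 1) <= 2 * (1 / 2) ^ n).
{ intros n; rewrite E, (geometric_expansion _ (S n) Hone), P.
  match goal with |- Cmod (?y + ?x - ?y)%C <= _ => replace (y + x - y)%C with x by ring end.
  eapply Rle_trans; [apply (remainder_bound (fun _ => 1) 1); [exact Hone|]|].
  - intros; rewrite Cmod_1; lra.
  - rewrite Rmult_1_r; apply Rmult_le_compat_l; [lra|].
    replace (1 / 2) with (/ 2) by lra; rewrite pow_inv; apply Rinv_le_contravar.
    + apply pow_lt; lra.
    + apply Rle_trans with (r ^ n); [apply pow_incr; lra|].
      apply Rle_pow; [lra | lia]. }
assert (Z : Cmod (mean q - 1) = 0).
{ apply Rle_antisym; [|apply Cmod_ge_0]; apply le_epsilon; intros e He.
  destruct (pow_lt_1_zero (1 / 2)) with (y := e / 2) as [n Hn];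
    [rewrite Rabs_right; lra | lra|].
  specialize (Hn n (le_n n)); rewrite Rabs_right in Hn by (apply Rle_ge, pow_le; lra).
  specialize (B n); lra. }
apply Cmod_eq_0 in Z; replace (mean q) with (mean q - 1 + 1)%C by ring.
rewrite Z; ring.
Qed.

(** The loop [gamma] may be replaced by [w + s (gamma - w)], on which [f] tends to
[f w] as [s] tends to 0. *)
Lemma Cauchy_formula (f : C -> C) : entire f ->
  mean (fun t => f (gamma t) * q t)%C = f w.
Proof.
intros Hf.
set (v := fun t => (gamma t - w)%C).
assert (Hv : forall t, Ccontinuous v t).
{ intros t; apply Ccontinuous_minus; [apply gamma_continuous | apply Ccontinuous_const]. }
assert (Hfc : forall s t, Ccontinuous (fun t => f (w + RtoC s * v t))%C t).
{ intros s t; apply (Ccontinuous_comp_entire f (fun t => w + RtoC s * v t)%C); [exact Hf|].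
  apply Ccontinuous_plus; [apply Ccontinuous_const|].
  apply Ccontinuous_mult; [apply Ccontinuous_const | apply Hv]. }
assert (vb : forall t, Cmod (v t) <= r + 1).
{ intros t; unfold v, Cminus; eapply Rle_trans; [apply Cmod_triangle|].
  rewrite Cmod_opp, Cmod_gamma; lra. }
assert (inv : forall s, 0 < s <= 1 ->
  mean (fun t => f (w + RtoC s * v t) * q t)%C = mean (fun t => f (gamma t) * q t)%C).
{ intros s Hs.
  pose proof two_PI_pos as H2.
  assert (Hk : forall s', CInt (fun t => f (w + RtoC s' * v t) * (Ci * q t))%C 0 (2 * PI) =
               (Ci * CInt (fun t => f (w + RtoC s' * v t) * q t) 0 (2 * PI))%C).
  { intros s'; rewrite <- CInt_scal; [|lra|].
    - apply CInt_ext; [lra|]; intros; ring.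
    - intros t _; apply Ccontinuous_mult; [apply Hfc | apply q_continuous]. }
  pose proof (loop_integral_invariant f w v (fun t => Ci * gamma t)%C (fun t => Ci * q t)%C
    (2 * PI) (r + 1) 2 s 1 Hf) as I.
  rewrite !Hk in I.
  assert (I' : CInt (fun t => f (w + RtoC s * v t) * q t)%C 0 (2 * PI) =
               CInt (fun t => f (w + RtoC 1 * v t) * q t)%C 0 (2 * PI)).
  { assert (HCi : (- Ci * Ci)%C = 1) by (apply C_ext; simpl; ring).
    match goal with |- ?x = ?y =>
      replace x with (- Ci * Ci * x)%C by (rewrite HCi; ring);
      replace y with (- Ci * Ci * y)%C by (rewrite HCi; ring) end.
    (* [- Ci] undoes the factor [Ci] of the logarithmic derivative of [gamma - w]. *)
    rewrite <- !Cmult_assoc; f_equal; apply I; try lra.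
    - intros t; unfold v, gamma, cis; simpl; auto_derive; [trivial | ring].
    - intros t; unfold v, gamma, cis; simpl; auto_derive; [trivial | ring].
    - intros t; apply Ccontinuous_mult; [apply Ccontinuous_const | apply gamma_continuous].
    - intros t; apply Ccontinuous_mult; [apply Ccontinuous_const | apply q_continuous].
    - intros t; unfold v, q; field; apply gamma_minus_neq_0.
    - exact vb.
    - intros t; rewrite Cmod_mult, Cmod_Ci, Rmult_1_l; apply q_bound.
    - unfold v, gamma; now rewrite cis_2PI. }
  unfold mean; f_equal; rewrite I'; apply CInt_ext; [lra|].
  intros t _; f_equal; f_equal; unfold v; ring. }
assert (Z : Cmod (mean (fun t => f (gamma t) * q t) - f w)%C = 0).
{ apply Rle_antisym; [|apply Cmod_ge_0]; apply le_epsilon; intros e He.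
  destruct (entire_continuous f w Hf (e / 2)) as [d [Hd Hc]]; [lra|].
  set (s := Rmin 1 (d / (r + 2))).
  assert (Hs : 0 < s <= 1).
  { unfold s; split; [apply Rmin_glb_lt; [lra | apply Rdiv_lt_0_compat; lra] | apply Rmin_l]. }
  assert (Hsd : s * (r + 1) < d).
  { apply Rlt_le_trans with (s * (r + 2)); [nra|].
    apply Rle_trans with (d / (r + 2) * (r + 2)).
    - apply Rmult_le_compat_r; [lra | apply Rmin_r].
    - right; field; lra. }
  rewrite <- (inv s Hs).
  replace (f w) with (f w * mean q)%C by (rewrite mean_q; ring).
  replace (mean (fun t => f (w + RtoC s * v t) * q t) - f w * mean q)%C with
    (mean (fun t => (f (w + RtoC s * v t) - f w) * q t))%C.
  - rewrite Rplus_0_l; apply mean_bound.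
    + intros t; apply Ccontinuous_mult; [|apply q_continuous].
      apply Ccontinuous_minus; [apply Hfc | apply Ccontinuous_const].
    + intros t; rewrite Cmod_mult; replace e with (e / 2 * 2) by field.
      apply Rmult_le_compat; auto using Cmod_ge_0; [|apply q_bound].
      apply Rlt_le, Hc; replace (w + RtoC s * v t - w)%C with (RtoC s * v t)%C by ring.
      rewrite Cmod_mult, Cmod_R, Rabs_right by lra.
      eapply Rle_lt_trans; [|exact Hsd]; apply Rmult_le_compat_l; [lra | apply vb].
  - rewrite (mean_ext _ (fun t => f (w + RtoC s * v t) * q t + - f w * q t)%C)
      by (intros; ring).
    rewrite mean_plus, mean_scal; [ring| | |].
    + apply q_continuous.
    + intros t; apply Ccontinuous_mult; [apply Hfc | apply q_continuous].
    + intros t; apply Ccontinuous_mult; [apply Ccontinuous_const | apply q_continuous]. }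
apply Cmod_eq_0 in Z.
replace (mean (fun t => f (gamma t) * q t)%C) with
  (mean (fun t => f (gamma t) * q t) - f w + f w)%C by ring.
rewrite Z; ring.
Qed.

End CircleIntegrals.

(** Each radius gives coefficients of its own, through Cauchy's formula on that
circle.  They agree: two polynomials that both approximate [f] on the disk up to a
remainder tending to 0 geometrically have coefficients that are as close as the
remainders.  This is what allows a different radius for each coefficient. *)
Lemma entire_Taylor (f : C -> C) (M : R -> R) : entire f ->
  (forall z, Cmod (f z) <= M (Cmod z)) ->
  exists a : nat -> C, forall r, 2 <= r ->
    (forall k, Cmod (a k) <= M r / r ^ k) /\
    (forall n w, Cmod w < 1 -> Cmod (f w - poly_sum a n w) <= 2 * M r / r ^ n).
Proof.
intros Hf HM.
set (coef := fun r k => mean (fun t => f (RtoC r * cis t) * (/ (RtoC r * cis t)) ^ k)%C).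
assert (Hfc : forall r t, Ccontinuous (fun t => f (RtoC r * cis t)%C) t).
{ intros r t; apply (Ccontinuous_comp_entire f (fun t => RtoC r * cis t)%C); [exact Hf|].
  apply gamma_continuous. }
assert (Hfb : forall r t, 2 <= r -> Cmod (f (RtoC r * cis t)%C) <= M r).
{ intros r t Hr; rewrite <- (Cmod_gamma r Hr t) at 2; apply HM. }
assert (approx : forall r n w, 2 <= r -> Cmod w < 1 ->
  Cmod (f w - poly_sum (coef r) n w) <= 2 * M r / r ^ n).
{ intros r n w Hr Hw.
  rewrite <- (Cauchy_formula w r Hw Hr f Hf).
  rewrite (geometric_expansion w r Hw Hr (fun t => f (RtoC r * cis t)%C) n) by apply Hfc.
  fold (coef r).
  match goal with |- Cmod (?x + ?y - ?x)%C <= _ => replace (x + y - x)%C with y by ring end.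
  apply (remainder_bound w r Hw Hr (fun t => f (RtoC r * cis t)%C)); auto. }
assert (same : forall r k, 2 <= r -> coef 2 k = coef r k).
{ intros r k Hr.
  assert (Mnn : forall r, 2 <= r -> 0 <= M r).
  { intros r' Hr'; eapply Rle_trans; [apply Cmod_ge_0 | apply (Hfb r' 0 Hr')]. }
  pose proof (Mnn 2 ltac:(lra)) as M2; pose proof (Mnn r Hr) as Mr.
  assert (B : forall n, Cmod (coef 2 k - coef r k)%C <= (2 * M 2 + 2 * M r) * (1 / 2) ^ n).
  { intros n.
    set (m := (n + S k)%nat).
    apply (poly_coef_bound (fun k => coef 2 k - coef r k)%C m k); [unfold m; lia|].
    intros z Hz; rewrite poly_sum_minus.
    replace (poly_sum (coef 2) m z - poly_sum (coef r) m z)%C with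
      ((f z - poly_sum (coef r) m z) + - (f z - poly_sum (coef 2) m z))%C by ring.
    eapply Rle_trans; [apply Cmod_triangle|]; rewrite Cmod_opp.
    pose proof (approx r m z Hr Hz) as A1; pose proof (approx 2 m z ltac:(lra) Hz) as A2.
    assert (P : forall x, 2 <= x -> / x ^ m <= (1 / 2) ^ n).
    { intros x Hx; replace (1 / 2) with (/ 2) by lra; rewrite pow_inv.
      apply Rinv_le_contravar; [apply pow_lt; lra|].
      apply Rle_trans with (x ^ n); [apply pow_incr; lra|].
      apply Rle_pow; [lra | unfold m; lia]. }
    pose proof (P r Hr) as P1; pose proof (P 2 ltac:(lra)) as P2.
    unfold Rdiv in A1, A2.
    assert (2 * M r * / r ^ m <= 2 * M r * (1 / 2) ^ n) by (apply Rmult_le_compat_l; lra).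
    assert (2 * M 2 * / 2 ^ m <= 2 * M 2 * (1 / 2) ^ n) by (apply Rmult_le_compat_l; lra).
    lra. }
  assert (Z : Cmod (coef 2 k - coef r k)%C = 0).
  { apply Rle_antisym; [|apply Cmod_ge_0]; apply le_epsilon; intros e He.
    set (N := 2 * M 2 + 2 * M r) in *.
    destruct (pow_lt_1_zero (1 / 2)) with (y := e / (N + 1)) as [n Hn];
      [rewrite Rabs_right; lra | apply Rdiv_lt_0_compat; unfold N; lra|].
    specialize (Hn n (le_n n)); rewrite Rabs_right in Hn by (apply Rle_ge, pow_le; lra).
    specialize (B n).
    assert (N * (1 / 2) ^ n <= N * (e / (N + 1))) by (apply Rmult_le_compat_l; unfold N in *; lra).
    assert (N * (e / (N + 1)) <= e).
    { replace (N * (e / (N + 1))) with (e - e / (N + 1)) by (field; unfold N; lra).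
      assert (0 < e / (N + 1)) by (apply Rdiv_lt_0_compat; unfold N; lra); lra. }
    lra. }
  apply Cmod_eq_0 in Z; replace (coef 2 k) with (coef 2 k - coef r k + coef r k)%C by ring.
  rewrite Z; ring. }
exists (coef 2); intros r Hr; split.
- intros k; rewrite (same r k Hr); apply mean_bound.
  + intros t; apply Ccontinuous_mult; [apply Hfc | now apply gamma_inv_pow_continuous].
  + intros t; rewrite Cmod_mult; apply Rmult_le_compat; auto using Cmod_ge_0.
    right; now apply Cmod_gamma_inv_pow.
- intros n w Hw; rewrite (poly_sum_ext _ (coef r)) by (intros; now apply same).
  now apply approx.
Qed.

(** * Polynomials as points of the metric space *)

Lemma ex_derive_of_expansion (f : C -> C) (z l : C) :
  (forall e, 0 < e -> exists d, 0 < d /\ forall z', Cmod (z' - z) < d ->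
     Cmod (f z' - f z - l * (z' - z)) <= e * Cmod (z' - z)) ->
  @ex_derive C_AbsRing C_NormedModule f z.
Proof.
intros H; exists l; split; [apply is_linear_scal_l|].
intros x Hx.
assert (E : z = x) by (apply (is_filter_lim_locally_unique (V := AbsRing_NormedModule C_AbsRing)), Hx).
subst x; intros e; destruct (H e (cond_pos e)) as [d [Hd H']].
exists (mkposreal d Hd); intros z' Hz'; specialize (H' z' Hz').
replace (f z' - f z - l * (z' - z))%C with (f z' - f z - (z' - z) * l)%C in H' by ring.
exact H'.
Qed.

(** The product rule with the identity as one factor is enough for polynomials, by
induction on the exponent of a monomial. *)
Lemma entire_id_mult (f : C -> C) : entire f -> entire (fun z => z * f z)%C.
Proof.
intros Hf z; destruct (entire_expansion f z Hf) as [l Hl].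
apply (ex_derive_of_expansion _ z (f z + z * l)%C); intros e He.
pose proof (Cmod_ge_0 z) as Hz0; pose proof (Cmod_ge_0 l) as Hl0.
destruct (Hl (e / (2 * (Cmod z + 1)))) as [d [Hd H]]; [apply Rdiv_lt_0_compat; lra|].
set (e1 := e / (2 * (Cmod z + 1))) in *.
set (L := e1 + Cmod l + 1).
assert (He1 : 0 < e1) by (apply Rdiv_lt_0_compat; lra).
assert (HL : 0 < L) by (unfold L; lra).
exists (Rmin d (e / (2 * L))); split.
{ apply Rmin_glb_lt; [exact Hd | apply Rdiv_lt_0_compat; lra]. }
intros z' Hz'.
pose proof (Rmin_l d (e / (2 * L))); pose proof (Rmin_r d (e / (2 * L))).
specialize (H z' ltac:(lra)).
replace (z' * f z' - z * f z - (f z + z * l) * (z' - z))%C with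
  (z * (f z' - f z - l * (z' - z)) + (z' - z) * ((f z' - f z - l * (z' - z)) + l * (z' - z)))%C
  by ring.
set (D := (f z' - f z - l * (z' - z))%C) in *; set (x := (z' - z)%C) in *.
eapply Rle_trans; [apply Cmod_triangle|]; rewrite !Cmod_mult.
assert (H2 : Cmod (D + l * x) <= L * Cmod x).
{ eapply Rle_trans; [apply Cmod_triangle|]; rewrite Cmod_mult.
  unfold L; pose proof (Cmod_ge_0 x); lra. }
assert (H3 : L * Cmod x <= e / 2).
{ apply Rle_trans with (L * (e / (2 * L))); [apply Rmult_le_compat_l; lra|].
  right; field; lra. }
assert (H4 : Cmod z * Cmod D <= e / 2 * Cmod x).
{ apply Rle_trans with ((Cmod z + 1) * (e1 * Cmod x)).
  - apply Rmult_le_compat; auto using Cmod_ge_0; lra.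
  - right; unfold e1; field; lra. }
assert (H5 : Cmod x * Cmod (D + l * x) <= Cmod x * (e / 2))
  by (apply Rmult_le_compat_l; [apply Cmod_ge_0 | lra]).
lra.
Qed.

Lemma entire_poly_sum (a : nat -> C) (n : nat) : entire (poly_sum a n).
Proof.
assert (mono : forall (c : C) k, entire (fun z => c * z ^ k)%C).
{ intros c k; induction k as [|k IH]; intros z.
  - exact (ex_derive_const (c * 1)%C z).
  - eapply ex_derive_ext; [|exact (entire_id_mult _ IH z)].
    intros t; simpl; ring. }
induction n as [|n IH]; intros z; [exact (ex_derive_const (RtoC 0) z)|].
apply (ex_derive_plus (poly_sum a n)); [apply IH | apply mono].
Qed.

Fixpoint Rsum (b : nat -> R) (n : nat) : R :=
  match n with
  | O => 0
  | S n => Rsum b n + b n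
  end.

Lemma Rsum_le (b c : nat -> R) (n : nat) :
  (forall k, (k < n)%nat -> b k <= c k) -> Rsum b n <= Rsum c n.
Proof.
induction n as [|n IH]; intros H; simpl; [lra|].
apply Rplus_le_compat; [apply IH; intros; apply H; lia | apply H; lia].
Qed.

Lemma Rsum_plus (b c : nat -> R) (n : nat) :
  Rsum (fun k => b k + c k) n = Rsum b n + Rsum c n.
Proof. induction n as [|n IH]; simpl; [ring | rewrite IH; ring]. Qed.

Lemma Rsum_scal (x : R) (b : nat -> R) (n : nat) :
  Rsum (fun k => x * b k) n = x * Rsum b n.
Proof. induction n as [|n IH]; simpl; [ring | rewrite IH; ring]. Qed.

Lemma Rsum_const (x : R) (n : nat) : Rsum (fun _ => x) n = INR n * x.
Proof. induction n as [|n IH]; [simpl; ring | rewrite S_INR; simpl Rsum; rewrite IH; ring]. Qed.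

Lemma poly_sum_bound (a : nat -> C) (b : nat -> R) (n : nat) (z : C) :
  (forall k, (k < n)%nat -> Cmod (a k * z ^ k) <= b k) ->
  Cmod (poly_sum a n z) <= Rsum b n.
Proof.
induction n as [|n IH]; intros H; simpl; [rewrite Cmod_0; lra|].
eapply Rle_trans; [apply Cmod_triangle|].
apply Rplus_le_compat; [apply IH; intros; apply H; lia | apply H; lia].
Qed.

Lemma poly_sum_disk_bound (a : nat -> C) (b : nat -> R) (n : nat) (z : C) : Cmod z < 1 ->
  (forall k, (k < n)%nat -> Cmod (a k) <= b k) ->
  Cmod (poly_sum a n z) <= Rsum b n.
Proof.
intros Hz H; apply poly_sum_bound; intros k Hk.
rewrite Cmod_mult, Cmod_pow, <- (Rmult_1_r (b k)).
apply Rmult_le_compat; auto using Cmod_ge_0, pow_le.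
rewrite <- (pow1 k); apply pow_incr; split; [apply Cmod_ge_0 | lra].
Qed.

Lemma poly_analytic_bounded (a : nat -> C) (n : nat) :
  let p := fun w : unit_disk => poly_sum a n w in
  analytic_on_disk p /\ bounded_on_disk p.
Proof.
split.
- exists (poly_sum a n); split; [intros z _; apply entire_poly_sum | reflexivity].
- exists (Rsum (fun k => Cmod (a k)) n); intros w.
  apply poly_sum_disk_bound; [exact (proj2_sig w) | intros; apply Rle_refl].
Qed.

Definition poly_point (n : nat) (a : nat -> C) : bounded_analytic :=
  exist _ (fun w : unit_disk => poly_sum a n w) (poly_analytic_bounded a n).

Lemma poly_point_coef_dist (n k : nat) (a b : nat -> C) : (k < n)%nat ->
  Cmod (a k - b k) <= Defs.d1 (poly_point n a) (poly_point n b).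
Proof.
intros Hk; apply (poly_coef_bound (fun k => a k - b k)%C n k); [exact Hk|].
intros z Hz; rewrite poly_sum_minus.
exact (d1_ub (poly_point n a) (poly_point n b) (exist _ z Hz)).
Qed.

(** The coefficients are dominated by those of [B * exp (A * r)]. *)
Lemma poly_point_F_exp (A B : R) (n : nat) (a : nat -> C) : 0 < A -> 0 < B ->
  (forall k, (k < n)%nat -> Cmod (a k) <= B * (A ^ k / INR (fact k))) ->
  F_exp_disk A B (poly_point n a).
Proof.
intros hA hB Ha; exists (poly_sum a n); split; [|reflexivity].
split; [apply entire_poly_sum|]; intros z.
assert (H0 : 0 <= A * Cmod z) by (apply Rmult_le_pos; [lra | apply Cmod_ge_0]).
apply Rle_trans with (Rsum (fun k => B * ((A * Cmod z) ^ k / INR (fact k))) n).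
- apply poly_sum_bound; intros k Hk; rewrite Cmod_mult, Cmod_pow, Rpow_mult_distr.
  replace (B * (A ^ k * Cmod z ^ k / INR (fact k)))
    with (B * (A ^ k / INR (fact k)) * Cmod z ^ k) by (unfold Rdiv; ring).
  apply Rmult_le_compat_r; [apply pow_le, Cmod_ge_0 | now apply Ha].
- rewrite Rsum_scal; apply Rmult_le_compat_l; [lra|].
  destruct n as [|n]; [simpl; apply Rlt_le, exp_pos|].
  eapply Rle_trans; [|apply (exp_ge_taylor _ n H0)]; right.
  induction n as [|n IH]; [simpl; ring|].
  cbn [Rsum sum_f_R0] in *; rewrite IH; [reflexivity | intros; apply Ha; lia].
Qed.

(** * Finite families of coefficient vectors *)

Definition extend (n : nat) (p : (nat -> C) * C) : nat -> C :=
  fun k => if Nat.eqb k n then snd p else fst p k.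

(** Coefficient vectors of length [n] are functions vanishing from [n] on, so that two
of them with the same entries are equal. *)
Fixpoint choices (G : nat -> list C) (n : nat) : list (nat -> C) :=
  match n with
  | O => (fun _ => RtoC 0) :: nil
  | S n => map (extend n) (list_prod (choices G n) (G n))
  end.

Lemma length_choices (G : nat -> list C) (n : nat) :
  (forall k, G k <> nil) ->
  (0 < length (choices G n))%nat /\
  ln (INR (length (choices G n))) = Rsum (fun k => ln (INR (length (G k)))) n.
Proof.
intros HG; induction n as [|n [IH0 IH]]; cbn [choices Rsum].
- simpl; split; [lia | apply ln_1].
- rewrite length_map, length_prod, mult_INR.
  assert (Hn : (0 < length (G n))%nat) by (specialize (HG n); destruct (G n); [easy | simpl; lia]).
  split; [nia|]; rewrite ln_mult, IH by (now apply lt_0_INR); reflexivity.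
Qed.

Lemma choices_intro (G : nat -> list C) (n : nat) (b : nat -> C) :
  (forall k, (k < n)%nat -> In (b k) (G k)) ->
  exists a, In a (choices G n) /\ forall k, (k < n)%nat -> a k = b k.
Proof.
induction n as [|n IH]; intros H.
- exists (fun _ => RtoC 0); split; [now left | lia].
- destruct IH as [a [Ha Hab]]; [intros; apply H; lia|].
  exists (extend n (a, b n)); split.
  + apply in_map, in_prod; [exact Ha | apply H; lia].
  + intros k Hk; unfold extend; simpl.
    destruct (Nat.eqb_spec k n) as [->|]; [reflexivity | apply Hab; lia].
Qed.

Lemma choices_elim (G : nat -> list C) (n : nat) (a : nat -> C) :
  In a (choices G n) ->
  (forall k, (k < n)%nat -> In (a k) (G k)) /\ (forall k, (n <= k)%nat -> a k = 0).
Proof.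
revert a; induction n as [|n IH]; intros a; cbn [choices].
- intros [<-|[]]; split; [lia | reflexivity].
- intros H; apply in_map_iff in H; destruct H as [[b g] [<- H]].
  apply in_prod_iff in H; destruct H as [Hb Hg]; destruct (IH b Hb) as [H1 H2].
  unfold extend; simpl; split; intros k Hk; destruct (Nat.eqb_spec k n) as [->|];
    try assumption; try lia; [apply H1; lia | apply H2; lia].
Qed.

Lemma choices_ext (G : nat -> list C) (n : nat) (a b : nat -> C) :
  In a (choices G n) -> In b (choices G n) ->
  (forall k, (k < n)%nat -> a k = b k) -> a = b.
Proof.
intros Ha Hb H; apply functional_extensionality; intros k.
destruct (Nat.lt_ge_cases k n) as [Hk|Hk]; [now apply H|].
rewrite (proj2 (choices_elim G n a Ha) k Hk), (proj2 (choices_elim G n b Hb) k Hk).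
reflexivity.
Qed.

Lemma NoDup_list_prod {X Y : Type} (l : list X) (l' : list Y) :
  NoDup l -> NoDup l' -> NoDup (list_prod l l').
Proof.
intros Hl Hl'; induction Hl as [|x l Hx Hl IH]; simpl; [constructor|].
apply NoDup_app; [|exact IH|].
- apply NoDup_map_NoDup_ForallPairs; [|exact Hl'].
  intros y y' _ _ E; congruence.
- intros [x' y] H1 H2; apply in_map_iff in H1; destruct H1 as [y' [E _]].
  injection E as <- _; apply in_prod_iff in H2; tauto.
Qed.

Lemma NoDup_choices (G : nat -> list C) (n : nat) :
  (forall k, NoDup (G k)) -> NoDup (choices G n).
Proof.
intros HG; induction n as [|n IH]; cbn [choices].
- constructor; [easy | constructor].
- apply NoDup_map_NoDup_ForallPairs; [|now apply NoDup_list_prod].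
  intros [a x] [b y] Ha Hb E.
  apply in_prod_iff in Ha; apply in_prod_iff in Hb.
  assert (Ek : forall k, extend n (a, x) k = extend n (b, y) k) by (intros; now rewrite E).
  unfold extend in Ek; simpl in Ek; f_equal.
  + apply (choices_ext G n); try tauto; intros k Hk; specialize (Ek k).
    destruct (Nat.eqb_spec k n); [lia | exact Ek].
  + specialize (Ek n); now rewrite Nat.eqb_refl in Ek.
Qed.

(** * Square grids *)

Definition nat_floor (x : R) : nat := Z.to_nat (Int_part x).

Lemma nat_floor_spec (x : R) : 0 <= x -> INR (nat_floor x) <= x < INR (nat_floor x) + 1.
Proof.
intros Hx; destruct (base_Int_part x) as [H1 H2].
unfold nat_floor; rewrite INR_IZR_INZ, Z2Nat.id; [lra|].
assert (-1 < Int_part x)%Z by (apply lt_IZR; lra); lia.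
Qed.

Definition line_grid (x0 h : R) (m : nat) : list R :=
  map (fun j => x0 + INR j * h) (seq 0 m).

Definition square_grid (x0 h : R) (m : nat) : list C :=
  list_prod (line_grid x0 h m) (line_grid x0 h m).

Lemma length_square_grid (x0 h : R) (m : nat) :
  length (square_grid x0 h m) = (m * m)%nat.
Proof.
etransitivity; [apply (length_prod (line_grid x0 h m))|].
unfold line_grid; now rewrite length_map, length_seq.
Qed.

Lemma ln_length_square_grid (x0 h : R) (m : nat) : (0 < m)%nat ->
  ln (INR (length (square_grid x0 h m))) = 2 * ln (INR m).
Proof.
intros Hm; rewrite length_square_grid, mult_INR, ln_mult by (now apply lt_0_INR); ring.
Qed.

Lemma square_grid_neq_nil (x0 h : R) (m : nat) : square_grid x0 h (S m) <> nil.
Proof. intros H; apply (f_equal (@length C)) in H; rewrite length_square_grid in H; simpl in H; lia. Qed.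

Lemma line_grid_approx (c h x : R) : 0 < h -> - c <= x <= c ->
  exists y, In y (line_grid (- c) h (S (nat_floor (2 * c / h)))) /\ Rabs (x - y) <= h.
Proof.
intros Hh Hx.
assert (H1 : 0 <= (x + c) / h) by (apply Rdiv_le_0_compat; lra).
assert (H2 : (x + c) / h <= 2 * c / h).
{ apply Rmult_le_compat_r; [apply Rlt_le, Rinv_0_lt_compat, Hh | lra]. }
destruct (nat_floor_spec _ H1) as [F1 F2]; destruct (nat_floor_spec (2 * c / h)) as [F3 F4]; [lra|].
set (j := nat_floor ((x + c) / h)) in *.
exists (- c + INR j * h); split.
- unfold line_grid; apply in_map_iff; exists j; split; [reflexivity|].
  apply in_seq; split; [lia|]; simpl; apply INR_lt; rewrite S_INR; lra.
- assert (E : x + c = (x + c) / h * h) by (field; lra).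
  apply Rabs_le.
  assert (INR j * h <= (x + c) / h * h) by (apply Rmult_le_compat_r; lra).
  assert ((x + c) / h * h <= (INR j + 1) * h) by (apply Rmult_le_compat_r; lra).
  lra.
Qed.

Lemma square_grid_approx (c h : R) (z : C) : 0 < h -> Cmod z <= c ->
  exists g, In g (square_grid (- c) h (S (nat_floor (2 * c / h)))) /\ Cmod (z - g) <= 2 * h.
Proof.
intros Hh Hz; pose proof (Re_le_Cmod z) as Hr; pose proof (Im_le_Cmod z) as Hi.
destruct (line_grid_approx c h (Re z) Hh) as [x [Hx1 Hx2]].
{ apply Rabs_le_between; lra. }
destruct (line_grid_approx c h (Im z) Hh) as [y [Hy1 Hy2]].
{ apply Rabs_le_between; lra. }
exists ((x, y) : C); split; [now apply in_prod|].
eapply Rle_trans; [apply Cmod_le_Re_Im|].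
change (Rabs (Re z - x) + Rabs (Im z - y) <= 2 * h); lra.
Qed.

Lemma line_grid_separated (x0 h : R) (m : nat) (x y : R) : 0 < h ->
  In x (line_grid x0 h m) -> In y (line_grid x0 h m) -> x <> y -> h <= Rabs (x - y).
Proof.
intros Hh Hx Hy; unfold line_grid in *.
apply in_map_iff in Hx; apply in_map_iff in Hy.
destruct Hx as [i [<- _]], Hy as [j [<- _]]; intros Hne.
replace (x0 + INR i * h - (x0 + INR j * h)) with ((INR i - INR j) * h) by ring.
rewrite Rabs_mult, (Rabs_right h) by lra.
rewrite <- (Rmult_1_l h) at 1; apply Rmult_le_compat_r; [lra|].
rewrite !INR_IZR_INZ, <- minus_IZR, <- abs_IZR; apply IZR_le.
destruct (Nat.eq_dec i j) as [->|]; [easy | lia].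
Qed.

Lemma square_grid_separated (x0 h : R) (m : nat) (z z' : C) : 0 < h ->
  In z (square_grid x0 h m) -> In z' (square_grid x0 h m) -> z <> z' -> h <= Cmod (z - z').
Proof.
destruct z as [x y], z' as [x' y']; intros Hh Hz Hz' Hne.
apply in_prod_iff in Hz; apply in_prod_iff in Hz'.
destruct (Req_dec x x') as [E|E].
- eapply Rle_trans; [|apply Im_le_Cmod].
  apply (line_grid_separated x0 h m y y'); try tauto; congruence.
- eapply Rle_trans; [|apply Re_le_Cmod].
  apply (line_grid_separated x0 h m x x'); tauto.
Qed.

Lemma NoDup_square_grid (x0 h : R) (m : nat) : 0 < h -> NoDup (square_grid x0 h m).
Proof.
intros Hh; assert (H : NoDup (line_grid x0 h m)); [|now apply NoDup_list_prod].
apply NoDup_map_NoDup_ForallPairs; [|apply seq_NoDup].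
intros i j _ _ E; apply INR_eq; nra.
Qed.

Lemma square_grid_bound (c h : R) (z : C) : 0 < h -> 0 <= c ->
  In z (square_grid 0 h (S (nat_floor (c / (2 * h))))) -> Cmod z <= c.
Proof.
destruct z as [x y]; intros Hh Hc Hz; apply in_prod_iff in Hz.
assert (H : forall x, In x (line_grid 0 h (S (nat_floor (c / (2 * h))))) -> 0 <= x <= c / 2).
{ clear x y Hz; intros x Hx; apply in_map_iff in Hx; destruct Hx as [j [<- Hj]].
  apply in_seq in Hj; pose proof (pos_INR j).
  destruct (nat_floor_spec (c / (2 * h))) as [F _]; [apply Rdiv_le_0_compat; lra|].
  assert (Hj' : INR j <= INR (nat_floor (c / (2 * h)))) by (apply le_INR; lia).
  split; [nra|].
  apply Rle_trans with (c / (2 * h) * h); [|right; field; lra].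
  rewrite Rplus_0_l; apply Rmult_le_compat_r; lra. }
destruct Hz as [Hx Hy]; apply H in Hx; apply H in Hy.
eapply Rle_trans; [apply Cmod_le_Re_Im|]; simpl.
rewrite !Rabs_right; lra.
Qed.

(** * Covering and packing *)

Lemma covering_nodup (X : Metric_Space) (K : Base X -> Prop) (eps : R) (l : list (Base X)) :
  (forall x, K x -> exists y, In y l /\ dist X x y <= eps) ->
  exists l', is_covering X K eps l' /\ (length l' <= length l)%nat.
Proof.
intros H; set (dec := fun x y : Base X => excluded_middle_informative (x = y)).
exists (nodup dec l); split; [split|].
- apply NoDup_nodup.
- intros x Hx; destruct (H x Hx) as [y [Hy Hd]]; exists y; split; [|exact Hd].
  now apply nodup_In.
- apply NoDup_incl_length; [apply NoDup_nodup|].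
  intros x; apply nodup_In.
Qed.

Lemma covering_number_exists (X : Metric_Space) (K : Base X -> Prop) (eps : R)
  (l : list (Base X)) :
  is_covering X K eps l -> exists N, is_covering_number X K eps N.
Proof.
intros Hl.
assert (H : forall n l, is_covering X K eps l -> (length l <= n)%nat ->
  exists N, is_covering_number X K eps N).
{ clear l Hl; induction n as [|n IH]; intros l Hl Hn.
  - exists 0%nat; split; [exists l; split; [exact Hl | lia] | intros; lia].
  - destruct (classic (exists l', is_covering X K eps l' /\ (length l' <= n)%nat)) as [[l' [H1 H2]]|Hno].
    + now apply (IH l').
    + exists (S n); split.
      * exists l; split; [exact Hl|].
        destruct (Nat.eq_dec (length l) (S n)); [assumption|].
        exfalso; apply Hno; exists l; split; [exact Hl | lia].
      * intros l' Hl'; destruct (Nat.le_gt_cases (S n) (length l')); [assumption|].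
        exfalso; apply Hno; exists l'; split; [exact Hl' | lia]. }
now apply (H (length l) l).
Qed.

(** By the triangle inequality a ball of radius [eps] contains at most one point of
[P], so that sending a point to the centre of a ball containing it is injective. *)
Lemma packing_le_covering (X : Metric_Space) (K : Base X -> Prop) (eps : R)
  (P l : list (Base X)) : NoDup P -> (forall x, In x P -> K x) ->
  (forall x y, In x P -> In y P -> x <> y -> 2 * eps < dist X x y) ->
  is_covering X K eps l -> (length P <= length l)%nat.
Proof.
intros HP HK Hsep [_ Hl].
set (center := fun x => epsilon (inhabits x) (fun y => In y l /\ dist X x y <= eps)).
assert (Hc : forall x, In x P -> In (center x) l /\ dist X x (center x) <= eps).
{ intros x Hx; apply (epsilon_spec (inhabits x) (fun y => In y l /\ dist X x y <= eps)).
  now apply Hl, HK. }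
rewrite <- (length_map center P); apply NoDup_incl_length.
- apply NoDup_map_NoDup_ForallPairs; [|exact HP].
  intros x y Hx Hy E; apply NNPP; intros Hne.
  specialize (Hsep x y Hx Hy Hne).
  destruct (Hc x Hx) as [_ Dx]; destruct (Hc y Hy) as [_ Dy].
  pose proof (dist_tri X x y (center x)) as T.
  rewrite E in T at 2; rewrite (dist_sym X (center y) y) in T; lra.
- intros z Hz; apply in_map_iff in Hz; destruct Hz as [x [<- Hx]]; now apply Hc.
Qed.

(** * Coverings and packings of the class *)

(** Cauchy's estimate on the circle of radius [k + 2].  The optimal radius is [k / A],
but it only improves the bound by a factor [exp (O (k + 1))], and it may be less
than 2. *)
Definition coef_bound (A B : R) (k : nat) : R :=
  B * exp (A * (INR k + 2)) / (INR k + 2) ^ k.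

Lemma F_exp_Taylor (A B : R) (f : C -> C) : F_exp A B f ->
  exists a : nat -> C, (forall k, Cmod (a k) <= coef_bound A B k) /\
    forall n w, Cmod w < 1 -> Cmod (f w - poly_sum a n w) <= 2 * coef_bound A B n.
Proof.
intros [Hf Hb].
destruct (entire_Taylor f (fun r => B * exp (A * r)) Hf Hb) as [a Ha].
exists a; unfold coef_bound; split.
- intros k; pose proof (pos_INR k); now apply (Ha (INR k + 2)); lra.
- intros n w Hw; pose proof (pos_INR n).
  eapply Rle_trans; [apply (Ha (INR n + 2)); [lra | exact Hw]|].
  right; unfold Rdiv; ring.
Qed.

Lemma coef_bound_pos (A B : R) (k : nat) : 0 < B -> 0 < coef_bound A B k.
Proof.
intros hB; pose proof (pos_INR k).
apply Rdiv_lt_0_compat; [apply Rmult_lt_0_compat; [lra | apply exp_pos] | apply pow_lt; lra].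
Qed.

(** The mesh [h] is such that rounding the first [n] coefficients moves the
polynomial by at most [eps / 2] on the disk; the other half of [eps] is left for the
Taylor remainder.  The estimate is for any [m] up to the length of the list, so
that it applies to the covering number. *)
Lemma covering_upper (A B eps : R) (n : nat) : 0 < B -> 0 < eps ->
  2 * coef_bound A B n <= eps / 2 ->
  exists l, is_covering bounded_analytic_space (F_exp_disk A B) eps l /\
    forall m, (0 < m <= length l)%nat -> 
    ln (INR m) <= Rsum (fun k => 2 * ln (8 * (INR n + 1) * coef_bound A B k / eps + 1)) n.
Proof.
intros hB He Hn.
pose proof (pos_INR n) as Hn0.
set (h := eps / (4 * (INR n + 1))).
assert (Hh : 0 < h) by (apply Rdiv_lt_0_compat; lra).
set (m := fun k => S (nat_floor (2 * coef_bound A B k / h))).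
set (G := fun k => square_grid (- coef_bound A B k) h (m k)).
destruct (covering_nodup bounded_analytic_space (F_exp_disk A B) eps
  (map (poly_point n) (choices G n))) as [l [Hl1 Hl2]].
{ intros g [f [Hf Hg]].
  destruct (F_exp_Taylor A B f Hf) as [a [Ha Happ]].
  set (b := fun k => epsilon (inhabits (RtoC 0)) (fun y => In y (G k) /\ Cmod (a k - y) <= 2 * h)).
  assert (Hb : forall k, In (b k) (G k) /\ Cmod (a k - b k) <= 2 * h).
  { intros k; apply (epsilon_spec (inhabits (RtoC 0)) (fun y => In y (G k) /\ Cmod (a k - y) <= 2 * h)).
    now apply square_grid_approx. }
  destruct (choices_intro G n b) as [c [Hc1 Hc2]]; [intros; apply Hb|].
  exists (poly_point n c); split; [now apply in_map|].
  apply d1_least; intros w; rewrite Hg; simpl.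
  pose proof (proj2_sig w) as Hw; simpl in Hw.
  rewrite (poly_sum_ext c b) by exact Hc2.
  replace (f w - poly_sum b n w)%C with
    ((f w - poly_sum a n w) + poly_sum (fun k => a k - b k) n w)%C
    by (rewrite poly_sum_minus; ring).
  eapply Rle_trans; [apply Cmod_triangle|].
  assert (H1 : Cmod (poly_sum (fun k => a k - b k)%C n w) <= Rsum (fun _ => 2 * h) n).
  { apply poly_sum_disk_bound; [exact Hw | intros; apply Hb]. }
  rewrite Rsum_const in H1.
  assert (H2 : INR n * (2 * h) <= eps / 2).
  { replace (eps / 2) with ((INR n + 1) * (2 * h)) by (unfold h; field; lra).
    apply Rmult_le_compat_r; lra. }
  specialize (Happ n w Hw); lra. }
exists l; split; [exact Hl1|]; intros N [HN0 HN].
rewrite length_map in Hl2.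
assert (HG : forall k, G k <> nil) by (intros; apply square_grid_neq_nil).
destruct (length_choices G n HG) as [L0 L].
apply Rle_trans with (ln (INR (length (choices G n)))).
{ apply ln_le; [now apply lt_0_INR | apply le_INR; lia]. }
rewrite L; apply Rsum_le; intros k Hk; unfold G, m.
rewrite ln_length_square_grid by lia.
apply Rmult_le_compat_l; [lra|]; apply ln_le; [apply lt_0_INR; lia|].
pose proof (coef_bound_pos A B k hB) as Hc.
rewrite S_INR; destruct (nat_floor_spec (2 * coef_bound A B k / h)) as [F _].
{ apply Rdiv_le_0_compat; lra. }
apply Rplus_le_compat_r; eapply Rle_trans; [exact F|].
right; unfold h; field; lra.
Qed.

(** The polynomials with coefficients on grids of mesh [3 * eps] are separated by more
than [2 * eps], and the grids fit into the disks of [poly_point_F_exp]. *)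
Lemma covering_lower (A B eps : R) (n : nat) (l : list (Base bounded_analytic_space)) :
  0 < A -> 0 < B -> 0 < eps ->
  is_covering bounded_analytic_space (F_exp_disk A B) eps l ->
  (0 < length l)%nat /\
  Rsum (fun k => 2 * ln (B * (A ^ k / INR (fact k)) / (6 * eps))) n <= ln (INR (length l)).
Proof.
intros hA hB He Hl.
set (c := fun k => B * (A ^ k / INR (fact k))).
assert (Hc : forall k, 0 < c k).
{ intros k; apply Rmult_lt_0_compat; [lra|].
  apply Rdiv_lt_0_compat; [now apply pow_lt | apply lt_0_INR, lt_O_fact]. }
set (m := fun k => S (nat_floor (c k / (2 * (3 * eps))))).
set (G := fun k => square_grid 0 (3 * eps) (m k)).
assert (HG : forall k, G k <> nil) by (intros; apply square_grid_neq_nil).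
destruct (length_choices G n HG) as [L0 L].
assert (sep : forall a b, In a (choices G n) -> In b (choices G n) -> a <> b ->
  2 * eps < Defs.d1 (poly_point n a) (poly_point n b)).
{ intros a b Ha Hb Hab.
  destruct (classic (exists k, (k < n)%nat /\ a k <> b k)) as [[k [Hk Hne]]|Hno].
  - apply Rlt_le_trans with (3 * eps); [lra|].
    eapply Rle_trans; [|apply (poly_point_coef_dist n k a b Hk)].
    apply (square_grid_separated 0 (3 * eps) (m k)); try assumption; [lra | |].
    + now apply (choices_elim G n a Ha).
    + now apply (choices_elim G n b Hb).
  - exfalso; apply Hab, (choices_ext G n); try assumption.
    intros k Hk; apply NNPP; intros Hne; apply Hno; now exists k. }
assert (Hle : (length (choices G n) <= length l)%nat).
{ rewrite <- (length_map (poly_point n)).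
  apply (packing_le_covering bounded_analytic_space (F_exp_disk A B) eps); [| | |exact Hl].
  - apply NoDup_map_NoDup_ForallPairs.
    + intros a b Ha Hb E; apply NNPP; intros Hne; specialize (sep a b Ha Hb Hne).
      rewrite E, (proj2 (d1_refl _ _) eq_refl) in sep; lra.
    + apply NoDup_choices; intros k; apply NoDup_square_grid; lra.
  - intros x Hx; apply in_map_iff in Hx; destruct Hx as [a [<- Ha]].
    apply poly_point_F_exp; [assumption..|]; intros k Hk.
    apply (square_grid_bound (c k) (3 * eps)); [lra | apply Rlt_le, Hc|].
    now apply (choices_elim G n a Ha).
  - intros x y Hx Hy Hne.
    apply in_map_iff in Hx; destruct Hx as [a [<- Ha]].
    apply in_map_iff in Hy; destruct Hy as [b [<- Hb]].
    apply sep; try assumption; congruence. }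
split; [lia|].
apply Rle_trans with (ln (INR (length (choices G n)))).
2:{ apply ln_le; [now apply lt_0_INR | now apply le_INR]. }
rewrite L; apply Rsum_le; intros k Hk; unfold G, m.
rewrite ln_length_square_grid by lia.
apply Rmult_le_compat_l; [lra|]; fold (c k).
assert (Hpos : 0 < c k / (6 * eps)) by (apply Rdiv_lt_0_compat; [apply Hc | lra]).
apply ln_le; [exact Hpos|]; rewrite S_INR.
replace (2 * (3 * eps)) with (6 * eps) by ring.
apply Rlt_le, nat_floor_spec; lra.
Qed.

(** * The logarithm of the covering number *)

Lemma ln_le_sub1 (x : R) : 0 < x -> ln x <= x - 1.
Proof.
intros Hx; pose proof (exp_ineq1_le (ln x)) as H; rewrite exp_ln in H by exact Hx; lra.
Qed.

Lemma exp_le_compat (x y : R) : x <= y -> exp x <= exp y.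
Proof. intros [H | ->]; [apply Rlt_le, exp_increasing, H | apply Rle_refl]. Qed.

Lemma ln_le_cancel (x y : R) : 0 < x -> 0 < y -> ln x <= ln y -> x <= y.
Proof.
intros Hx Hy H; rewrite <- (exp_ln x), <- (exp_ln y) by assumption.
now apply exp_le_compat.
Qed.

Lemma ln_succ_le (x : R) : 0 < x -> ln (x + 1) <= ln x + / x.
Proof.
intros Hx; replace (x + 1) with (x * (1 + / x)) by (field; lra).
assert (0 < / x) by (now apply Rinv_0_lt_compat).
rewrite ln_mult by lra; pose proof (ln_le_sub1 (1 + / x) ltac:(lra)); lra.
Qed.

Lemma ln_pow_nat (x : R) (n : nat) : 0 < x -> ln (x ^ n) = INR n * ln x.
Proof.
intros Hx; induction n as [|n IH]; [simpl; rewrite ln_1; ring|].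
rewrite <- tech_pow_Rmult, ln_mult, IH, S_INR by (try apply pow_lt; lra); ring.
Qed.

Lemma ln_div_pos (x y : R) : 0 < x -> 0 < y -> ln (x / y) = ln x - ln y.
Proof.
intros Hx Hy; unfold Rdiv; rewrite ln_mult, ln_Rinv by (try apply Rinv_0_lt_compat; lra); ring.
Qed.

(** With [sum_k_ln_lower]: the sum of [2 k ln (k + 2)] over [k < n] is
[n^2 ln (n + 2) + O(n^2)], by comparing increments. *)
Lemma sum_k_ln_upper (n : nat) :
  Rsum (fun k => 2 * (INR k * ln (INR k + 2))) n <= INR n ^ 2 * ln (INR n + 2).
Proof.
induction n as [|n IH]; [simpl; lra|].
cbn [Rsum]; rewrite S_INR; pose proof (pos_INR n) as Hn.
assert (H0 : 0 <= ln (INR n + 2)) by (rewrite <- ln_1; apply ln_le; lra).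
assert (H1 : ln (INR n + 2) <= ln (INR n + 1 + 2)) by (apply ln_le; lra).
assert (H2 : (INR n + 1) ^ 2 * ln (INR n + 2) <= (INR n + 1) ^ 2 * ln (INR n + 1 + 2))
  by (apply Rmult_le_compat_l; [apply pow2_ge_0 | exact H1]).
lra.
Qed.

Lemma sum_k_ln_lower (n : nat) :
  INR n ^ 2 * ln (INR n + 2) - 3 * INR n ^ 2 <= Rsum (fun k => 2 * (INR k * ln (INR k + 2))) n.
Proof.
induction n as [|n IH]; [simpl; lra|].
cbn [Rsum]; rewrite S_INR; pose proof (pos_INR n) as Hn.
assert (H0 : ln (INR n + 2) <= INR n + 1) by (pose proof (ln_le_sub1 (INR n + 2)); lra).
pose proof (ln_succ_le (INR n + 2) ltac:(lra)) as H1.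
replace (INR n + 2 + 1) with (INR n + 1 + 2) in H1 by ring.
assert (H2 : (INR n + 1) ^ 2 * ln (INR n + 1 + 2) <= (INR n + 1) ^ 2 * (ln (INR n + 2) + / (INR n + 2)))
  by (apply Rmult_le_compat_l; [apply pow2_ge_0 | exact H1]).
assert (H3 : (INR n + 1) ^ 2 * / (INR n + 2) <= INR n + 1).
{ apply Rmult_le_reg_r with (INR n + 2); [lra|].
  rewrite Rmult_assoc, Rinv_l by lra; nra. }
nra.
Qed.

(** The least [n] satisfying the lower inequality works: the inequality fails at
[n - 1], and [n ln (n + 2)] grows by at most [O(n)] in one step. *)
Lemma degree_exists (K l : R) : 0 <= K -> 0 < l ->
  exists n : nat, (1 <= n)%nat /\
    l + K * INR n <= INR n * ln (INR n + 2) <= l + (K + 3) * INR n.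
Proof.
intros HK Hl.
set (P := fun n : nat => l + K * INR n <= INR n * ln (INR n + 2)).
assert (HP : exists n, P n).
{ destruct (INR_unbounded (exp (l + K))) as [n Hn].
  exists (S n); unfold P.
  assert (H : l + K <= ln (INR (S n) + 2)).
  { rewrite <- (ln_exp (l + K)); apply ln_le; [apply exp_pos | rewrite S_INR; lra]. }
  assert (1 <= INR (S n)) by (rewrite S_INR; pose proof (pos_INR n); lra).
  nra. }
destruct (dec_inh_nat_subset_has_unique_least_element P) as [n [[Hn Hleast] _]];
  [intros n; apply classic | exact HP|].
assert (H1 : (1 <= n)%nat).
{ destruct n; [|lia]; unfold P in Hn; simpl in Hn; lra. }
exists n; split; [exact H1|]; split; [exact Hn|].
destruct n as [|n]; [lia|].
assert (Hno : ~ P n) by (intros H; apply Hleast in H; lia).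
unfold P in Hno; rewrite S_INR; pose proof (pos_INR n).
assert (H0 : ln (INR n + 1 + 2) <= INR n + 2) by (pose proof (ln_le_sub1 (INR n + 1 + 2)); lra).
pose proof (ln_succ_le (INR n + 2) ltac:(lra)) as H2.
replace (INR n + 2 + 1) with (INR n + 1 + 2) in H2 by ring.
assert (H3 : INR n * / (INR n + 2) <= 1).
{ apply Rmult_le_reg_r with (INR n + 2); [lra|].
  rewrite Rmult_assoc, Rinv_l by lra; lra. }
assert (H4 : INR n * ln (INR n + 1 + 2) <= INR n * (ln (INR n + 2) + / (INR n + 2)))
  by (apply Rmult_le_compat_l; assumption).
nra.
Qed.

(** [K] is large enough for [l + K n <= n ln (n + 2)] to bring the Taylor remainder
below [eps / 2], see [tail_small]. *)
Section EntropyEstimate.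

Variables A B : R.
Hypothesis hA : 0 < A.
Hypothesis hB : 0 < B.

Let K : R := Rabs (ln (4 * B)) + 3 * A.

Lemma ln_coef_bound (k : nat) :
  ln (coef_bound A B k) = ln B + A * (INR k + 2) - INR k * ln (INR k + 2).
Proof.
pose proof (pos_INR k); unfold coef_bound.
rewrite ln_div_pos, ln_mult, ln_exp, ln_pow_nat;
  try apply Rmult_lt_0_compat; try apply exp_pos; try apply pow_lt; lra.
Qed.

Lemma tail_small (eps : R) (n : nat) : 0 < eps -> (1 <= n)%nat ->
  ln (/ eps) + K * INR n <= INR n * ln (INR n + 2) ->
  2 * coef_bound A B n <= eps / 2.
Proof.
intros He Hn H.
assert (Hn1 : 1 <= INR n) by (apply (le_INR 1); exact Hn).
pose proof (coef_bound_pos A B n hB) as Hc.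
enough (4 * coef_bound A B n <= eps) by lra.
apply ln_le_cancel; [lra | exact He|].
rewrite ln_Rinv in H by exact He.
rewrite ln_mult, ln_coef_bound by lra.
assert (H4 : ln (4 * B) = ln 4 + ln B) by (apply ln_mult; lra).
pose proof (Rle_abs (ln (4 * B))); pose proof (Rabs_pos (ln (4 * B))).
unfold K in H; nra.
Qed.

Lemma covering_exists (eps : R) : 0 < eps ->
  exists N, is_covering_number bounded_analytic_space (F_exp_disk A B) eps N.
Proof.
intros He.
destruct (degree_exists K (Rmax 1 (ln (/ eps)))) as [n [Hn [H _]]].
- unfold K; pose proof (Rabs_pos (ln (4 * B))); lra.
- pose proof (Rmax_l 1 (ln (/ eps))); lra.
- destruct (covering_upper A B eps n hB He) as [l [Hl _]].
  + apply tail_small; try assumption; pose proof (Rmax_r 1 (ln (/ eps))); lra.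
  + exact (covering_number_exists _ _ _ l Hl).
Qed.

(** Both bounds are sums over [k < n] of [2 (l - k ln (k + 2)) + O(n)].  Their common
value [2 n l - n^2 ln (n + 2) + O(n^2)] is [n l + O(n^2)] by the choice of [n]. *)
Lemma entropy_estimate : exists K2, 0 <= K2 /\ forall (eps : R) (n N : nat), 0 < eps -> (1 <= n)%nat ->
  ln (/ eps) + K * INR n <= INR n * ln (INR n + 2) <= ln (/ eps) + (K + 3) * INR n ->
  is_covering_number bounded_analytic_space (F_exp_disk A B) eps N ->
  Rabs (ln (INR N) - INR n * ln (/ eps)) <= K2 * INR n ^ 2.
Proof.
pose proof (Rabs_pos (ln (4 * B))) as K4; pose proof (Rabs_pos (ln B)) as KB0;
  pose proof (Rabs_pos (ln A)) as KA0.
assert (K6 : 0 <= ln 6) by (rewrite <- ln_1; apply ln_le; lra).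
set (Ku := 2 * (28 + K + Rabs (ln B) + 3 * A) + 3).
set (Kl := K + 3 + 2 * (Rabs (ln B) + Rabs (ln A) + ln 6)).
assert (HK : 0 <= K) by (unfold K; lra).
exists (Ku + Kl); split; [unfold Ku, Kl; lra|].
intros eps n N He Hn [Hlow Hup] [[l0 [Hl0 HN]] Hmin].
set (el := ln (/ eps)) in *.
assert (Hn1 : 1 <= INR n) by (apply (le_INR 1); exact Hn).
pose proof (pow2_ge_0 (INR n)) as Hn2.
destruct (covering_lower A B eps n l0 hA hB He Hl0) as [Hpos Hlower].
rewrite HN in Hpos, Hlower.
destruct (covering_upper A B eps n hB He (tail_small eps n He Hn Hlow)) as [l1 [Hl1 Hupper]].
specialize (Hupper N (conj Hpos (Hmin l1 Hl1))).
pose proof (sum_k_ln_upper n) as Su; pose proof (sum_k_ln_lower n) as Sl.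
set (S := Rsum (fun k => 2 * (INR k * ln (INR k + 2))) n) in *.
assert (Hk : forall k, (k < n)%nat -> INR k + 1 <= INR n)
  by (intros k Hk; rewrite <- S_INR; apply le_INR; lia).
assert (U : Rsum (fun k => 2 * ln (8 * (INR n + 1) * coef_bound A B k / eps + 1)) n
  <= INR n * (2 * (el + (28 + K + Rabs (ln B) + 3 * A) * INR n)) - S).
{ rewrite <- Rsum_const; unfold S.
  replace (Rsum (fun _ => 2 * (el + (28 + K + Rabs (ln B) + 3 * A) * INR n)) n
    - Rsum (fun k => 2 * (INR k * ln (INR k + 2))) n) with
    (Rsum (fun k => 2 * (el + (28 + K + Rabs (ln B) + 3 * A) * INR n)
             + (-1) * (2 * (INR k * ln (INR k + 2)))) n)
    by (rewrite Rsum_plus, (Rsum_scal (-1)); ring).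
  apply Rsum_le; intros k Hkn; specialize (Hk k Hkn); pose proof (pos_INR k) as Hk0.
  set (Z := el + (Rabs (ln B) + 3 * A) * INR n - INR k * ln (INR k + 2)).
  pose proof (coef_bound_pos A B k hB) as Hc.
  assert (Hce : 0 < coef_bound A B k / eps) by (now apply Rdiv_lt_0_compat).
  assert (HZ : ln (coef_bound A B k / eps) <= Z).
  { rewrite ln_div_pos, ln_coef_bound by assumption.
    unfold Z, el; rewrite ln_Rinv by exact He.
    pose proof (Rle_abs (ln B)); nra. }
  assert (HZ' : - ((K + 3) * INR n) <= Z).
  { assert (INR k * ln (INR k + 2) <= INR n * ln (INR n + 2)).
    { apply Rmult_le_compat; try lra; [rewrite <- ln_1|]; apply ln_le; lra. }
    assert (0 <= (Rabs (ln B) + 3 * A) * INR n) by (apply Rmult_le_pos; lra).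
    unfold Z; lra. }
  (* [Z] bounds the logarithm of [coef_bound A B k / eps] and may be negative, when a
     single grid point suffices.  Raising it to [Z' >= 0] absorbs the summand 1, at a
     cost of [O(n)] for each [k]. *)
  set (Z' := Z + (K + 3) * INR n).
  assert (H1 : coef_bound A B k / eps <= exp Z').
  { rewrite <- (exp_ln (coef_bound A B k / eps)) by exact Hce.
    apply exp_le_compat; unfold Z'; nra. }
  assert (H2 : 1 <= exp Z').
  { rewrite <- exp_0; apply exp_le_compat; unfold Z'; lra. }
  assert (H3 : 8 * (INR n + 1) * coef_bound A B k / eps + 1 <= (8 * INR n + 9) * exp Z').
  { replace (8 * (INR n + 1) * coef_bound A B k / eps)
      with (8 * (INR n + 1) * (coef_bound A B k / eps)) by (unfold Rdiv; ring).
    nra. }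
  assert (H4 : ln (8 * (INR n + 1) * coef_bound A B k / eps + 1) <= 8 * INR n + 8 + Z').
  { eapply Rle_trans; [apply ln_le; [|exact H3]|].
    - replace (8 * (INR n + 1) * coef_bound A B k / eps)
        with (8 * (INR n + 1) * (coef_bound A B k / eps)) by (unfold Rdiv; ring); nra.
    - rewrite ln_mult, ln_exp by (apply exp_pos || lra).
      pose proof (ln_le_sub1 (8 * INR n + 9)); lra. }
  unfold Z', Z in H4; lra. }
assert (L : INR n * (2 * (el - (Rabs (ln B) + Rabs (ln A) + ln 6) * INR n)) - S <=
  Rsum (fun k => 2 * ln (B * (A ^ k / INR (fact k)) / (6 * eps))) n).
{ rewrite <- Rsum_const; unfold S.
  replace (Rsum (fun _ => 2 * (el - (Rabs (ln B) + Rabs (ln A) + ln 6) * INR n)) n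
    - Rsum (fun k => 2 * (INR k * ln (INR k + 2))) n) with
    (Rsum (fun k => 2 * (el - (Rabs (ln B) + Rabs (ln A) + ln 6) * INR n)
             + (-1) * (2 * (INR k * ln (INR k + 2)))) n)
    by (rewrite Rsum_plus, (Rsum_scal (-1)); ring).
  apply Rsum_le; intros k Hkn; specialize (Hk k Hkn); pose proof (pos_INR k) as Hk0.
  assert (Hf : 0 < INR (fact k)) by apply lt_0_INR, lt_O_fact.
  assert (HA : 0 < A ^ k) by (now apply pow_lt).
  assert (Hfact : ln (INR (fact k)) <= INR k * ln (INR k + 2)).
  { rewrite <- ln_pow_nat by lra; apply ln_le; [exact Hf|].
    clear; induction k as [|k IH]; [simpl; lra|].
    rewrite fact_simpl, mult_INR, S_INR, <- tech_pow_Rmult; pose proof (pos_INR k).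
    apply Rmult_le_compat; [lra | apply pos_INR | lra|].
    eapply Rle_trans; [exact IH|]; apply pow_incr; lra. }
  assert (HAf : 0 < A ^ k / INR (fact k)) by (now apply Rdiv_lt_0_compat).
  rewrite ln_div_pos, !ln_mult, ln_div_pos, ln_pow_nat
    by (lra || (apply Rmult_lt_0_compat; lra)).
  unfold el; rewrite ln_Rinv by exact He.
  pose proof (Rle_abs (- ln B)) as Q1; pose proof (Rle_abs (- ln A)) as Q2.
  rewrite Rabs_Ropp in Q1, Q2.
  assert (INR k * - ln A <= INR n * Rabs (ln A)) by (apply Rle_trans with (INR k * Rabs (ln A)); nra).
  assert (Rabs (ln B) <= Rabs (ln B) * INR n) by nra.
  assert (ln 6 <= ln 6 * INR n) by nra.
  lra. }
assert (T1 : INR n * (el + K * INR n) <= INR n * (INR n * ln (INR n + 2)))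
  by (apply Rmult_le_compat_l; lra).
assert (T2 : INR n * (INR n * ln (INR n + 2)) <= INR n * (el + (K + 3) * INR n))
  by (apply Rmult_le_compat_l; lra).
assert (0 <= K * INR n ^ 2) by (apply Rmult_le_pos; assumption).
assert (0 <= Ku * INR n ^ 2) by (apply Rmult_le_pos; [unfold Ku; lra | assumption]).
assert (0 <= Kl * INR n ^ 2) by (apply Rmult_le_pos; [unfold Kl; lra | assumption]).
apply Rabs_le; split; unfold Ku, Kl in *; nra.
Qed.

End EntropyEstimate.

(** * Asymptotic expansion *)
Lemma ln2_bounds : / 2 <= ln 2 <= 1.
Proof.
split; [|pose proof (ln_le_sub1 2); lra].
pose proof (ln_le_sub1 (/ 2) ltac:(lra)) as H; rewrite ln_Rinv in H by lra; lra.
Qed.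

Lemma log2_le (x y : R) : 0 < x -> x <= y -> log2 x <= log2 y.
Proof.
intros Hx Hxy; pose proof ln2_bounds; unfold log2.
apply Rmult_le_compat_r; [apply Rlt_le, Rinv_0_lt_compat; lra | now apply ln_le].
Qed.

Lemma log2_mult (x y : R) : 0 < x -> 0 < y -> log2 (x * y) = log2 x + log2 y.
Proof. intros Hx Hy; unfold log2; rewrite ln_mult by assumption; unfold Rdiv; ring. Qed.

Lemma log2_sqr_le (x : R) : 1 <= x -> log2 x ^ 2 <= 16 * x.
Proof.
intros Hx; pose proof ln2_bounds as H2.
assert (Hs : 0 < sqrt x) by (apply sqrt_lt_R0; lra).
assert (Hq : sqrt x * sqrt x = x) by (apply sqrt_sqrt; lra).
assert (H0 : 0 <= ln x) by (rewrite <- ln_1; apply ln_le; lra).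
assert (H1 : ln x <= 2 * sqrt x).
{ rewrite <- Hq at 1; rewrite ln_mult by assumption.
  pose proof (ln_le_sub1 _ Hs); lra. }
assert (H3 : 0 <= log2 x <= 4 * sqrt x).
{ unfold log2; split; [apply Rdiv_le_0_compat; lra|].
  apply Rmult_le_reg_r with (ln 2); [lra|].
  unfold Rdiv; rewrite Rmult_assoc, Rinv_l by lra; nra. }
nra.
Qed.

(** Put [Y = D + log2 D + kap].  Then [H / (n L) = 1 + rho / D], and
[Y (H Y / L^2 - 1 - log2 Y / Y)] is bounded by a constant that depends on [K1] and
[K2] only, whereas [eta * log2 Y] is unbounded as [D] grows. *)
Lemma asymptotic_expansion (K1 K2 eta : R) : 0 <= K1 -> 0 <= K2 -> 0 < eta ->
  exists D0, forall n D L Y H : R, D0 <= D -> 0 < n -> L = n * D ->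
    Rabs (Y - D - log2 D) <= K1 -> Rabs (H - n * L) <= K2 * n ^ 2 ->
    1 < L /\ 0 < Y ->
    Rabs (H * Y / L ^ 2 - 1 - log2 Y / Y) <= eta * (log2 Y / Y).
Proof.
intros HK1 HK2 Heta; pose proof ln2_bounds as Hln2.
set (M := Rmax (K1 + 1) ((65 + K1 + 4 * K2) / eta)).
exists (Rmax 64 (exp (M * ln 2))).
intros n D L Y H HD Hn HL HY HH [HL1 HY0].
pose proof (Rmax_l 64 (exp (M * ln 2))); pose proof (Rmax_r 64 (exp (M * ln 2))).
assert (HD64 : 64 <= D) by lra.
set (d := log2 D) in *.
assert (HMd : M <= d).
{ replace M with (log2 (exp (M * ln 2))) by (unfold log2; rewrite ln_exp; field; lra).
  apply log2_le; [apply exp_pos | lra]. }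
assert (Hd1 : K1 + 1 <= d) by (pose proof (Rmax_l (K1 + 1) ((65 + K1 + 4 * K2) / eta)); unfold M in *; lra).
assert (Hd2 : 65 + K1 + 4 * K2 <= eta * d).
{ apply Rle_trans with (eta * ((65 + K1 + 4 * K2) / eta)); [right; field; lra|].
  apply Rmult_le_compat_l; [lra|].
  pose proof (Rmax_r (K1 + 1) ((65 + K1 + 4 * K2) / eta)); unfold M in *; lra. }
pose proof (log2_sqr_le D ltac:(lra)) as Hsq; fold d in Hsq.
apply Rabs_le_between in HY.
assert (H2d : 2 * d <= D) by nra.
assert (HYD : D <= Y <= 2 * D) by lra.
assert (HU : d <= log2 Y <= d + 1).
{ split; [apply log2_le; lra|].
  replace (d + 1) with (log2 (D * 2)).
  - apply log2_le; lra.
  - rewrite log2_mult by lra; fold d; unfold log2 at 1; field; lra. }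
set (U := log2 Y) in *.
set (rho := (H - n * L) / n ^ 2).
assert (Hn2 : 0 < n ^ 2) by (apply pow_lt; exact Hn).
assert (Hrho : Rabs rho <= K2).
{ unfold rho, Rdiv; rewrite Rabs_mult, (Rabs_right (/ n ^ 2)) by (apply Rle_ge, Rlt_le, Rinv_0_lt_compat, Hn2).
  apply Rmult_le_reg_r with (n ^ 2); [exact Hn2|].
  rewrite Rmult_assoc, Rinv_l by lra; lra. }
set (x := Y / D).
assert (Hx : 1 <= x <= 2).
{ unfold x; split; apply Rmult_le_reg_r with D; try lra;
    unfold Rdiv; rewrite Rmult_assoc, Rinv_l by lra; lra. }
set (kap := Y - D - d).
assert (E : H * Y / L ^ 2 - 1 - U / Y =
  (kap + (d + kap) ^ 2 / D + rho * x ^ 2 - (U - d)) / Y).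
{ unfold rho, x, kap; rewrite HL; field; lra. }
rewrite E.
replace (eta * (U / Y)) with (eta * U / Y) by (unfold Rdiv; ring).
unfold Rdiv; rewrite Rabs_mult, (Rabs_right (/ Y)) by (apply Rle_ge, Rlt_le, Rinv_0_lt_compat, HY0).
apply Rmult_le_compat_r; [apply Rlt_le, Rinv_0_lt_compat, HY0|].
fold (Rdiv ((d + kap) ^ 2) D).
assert (B1 : 0 <= (d + kap) ^ 2 / D <= 64).
{ assert (0 <= d + kap <= 2 * d) by (unfold kap; lra).
  assert ((d + kap) ^ 2 <= (2 * d) ^ 2) by (apply pow_incr; assumption).
  split; [apply Rdiv_le_0_compat; [apply pow2_ge_0 | lra]|].
  apply Rmult_le_reg_r with D; [lra|].
  unfold Rdiv; rewrite Rmult_assoc, Rinv_l by lra; lra. }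
apply Rabs_le_between in Hrho.
assert (B2 : - (4 * K2) <= rho * x ^ 2 <= 4 * K2) by (assert (1 <= x ^ 2 <= 4) by nra; nra).
assert (B3 : eta * d <= eta * U) by (apply Rmult_le_compat_l; lra).
apply Rabs_le; unfold kap in *; lra.
Qed.

(** It remains to see that [D = L / n] exceeds any bound for small [eps].  Since
[l <= n ln (n + 2) <= n (n + 1)], a lower bound [X (X + 1)] of [l] forces [X <= n],
and [D] is [log2 (n + 2)] up to a bounded term. *)
Lemma entropy_expansion (A B eta : R) : 0 < A -> 0 < B -> 0 < eta ->
  exists delta, 0 < delta /\ forall eps, 0 < eps < delta ->
    let L := log2 (/ eps) in let Y := log_iter 2 (/ eps) in let U := log_iter 3 (/ eps) in
    let H := metric_entropy bounded_analytic_space (F_exp_disk A B) eps in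
    0 < L /\ 0 < Y /\ Rabs (H * Y / L ^ 2 - 1 - U / Y) <= eta * (U / Y).
Proof.
intros hA hB Heta; pose proof ln2_bounds as Hln2.
set (K := Rabs (ln (4 * B)) + 3 * A).
assert (HK : 0 <= K) by (unfold K; pose proof (Rabs_pos (ln (4 * B))); lra).
destruct (entropy_estimate A B hA hB) as [K2 [HK2 Hest]].
destruct (asymptotic_expansion (2 * (K + 5)) (2 * K2) eta) as [D0 HD0]; try lra.
set (D1 := Rmax 1 D0).
set (X := exp (D1 * ln 2 + (K + 3))).
assert (HX : 0 < X) by apply exp_pos.
exists (exp (- (X * (X + 1) + 1))); split; [apply exp_pos|].
intros eps [He Hed] L Y U H.
set (el := ln (/ eps)).
assert (Hel : X * (X + 1) + 1 <= el).
{ unfold el; rewrite ln_Rinv by exact He.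
  apply ln_increasing in Hed; [|exact He]; rewrite ln_exp in Hed; lra. }
assert (HXX : 0 < X * (X + 1)) by nra.
destruct (degree_exists K el HK ltac:(lra)) as [n [Hn Hdeg]].
assert (Hn1 : 1 <= INR n) by (apply (le_INR 1); exact Hn).
assert (Hln : ln (INR n + 2) <= INR n + 1) by (pose proof (ln_le_sub1 (INR n + 2)); lra).
assert (HXn : X <= INR n).
{ assert (0 <= K * INR n) by (apply Rmult_le_pos; lra).
  assert (INR n * ln (INR n + 2) <= INR n * (INR n + 1)) by (apply Rmult_le_compat_l; lra).
  apply Rnot_lt_le; intros Hlt; nra. }
assert (HlnX : D1 * ln 2 + (K + 3) <= ln (INR n + 2)).
{ rewrite <- (ln_exp (D1 * ln 2 + (K + 3))); apply ln_le; [apply exp_pos | fold X; lra]. }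
set (D := L / INR n).
assert (HLel : L * ln 2 = el) by (unfold L, log2, el; field; lra).
assert (HLD : L = INR n * D) by (unfold D; field; lra).
assert (Dup : ln (INR n + 2) - (K + 3) <= D * ln 2 <= ln (INR n + 2) - K).
{ rewrite HLD in HLel; split; apply Rmult_le_reg_l with (INR n); lra. }
assert (HDD : D1 <= D) by (apply Rmult_le_reg_r with (ln 2); lra).
assert (HD1 : 1 <= D) by (pose proof (Rmax_l 1 D0); unfold D1 in *; lra).
assert (HD0D : D0 <= D) by (pose proof (Rmax_r 1 D0); unfold D1 in *; lra).
assert (HL1 : 1 < L).
{ apply Rmult_lt_reg_r with (ln 2); [lra|]; rewrite HLel; lra. }
assert (HY0 : 0 < Y).
{ change (0 < log2 L); unfold log2; apply Rdiv_lt_0_compat; [|lra].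
  rewrite <- ln_1; apply ln_increasing; lra. }
split; [lra|]; split; [exact HY0|].
apply (HD0 (INR n) D L Y H HD0D); [lra | exact HLD | | | split; assumption].
- change Y with (log2 L); rewrite HLD, log2_mult by lra.
  assert (Hn2 : ln (INR n) <= ln (INR n + 2) <= ln (INR n) + 2).
  { split; [apply ln_le; lra|].
    apply Rle_trans with (ln (INR n * 3)); [apply ln_le; lra|].
    rewrite ln_mult by lra; pose proof (ln_le_sub1 3); lra. }
  apply Rabs_le; unfold log2.
  replace (ln (INR n) / ln 2 + ln D / ln 2 - D - ln D / ln 2)
    with ((ln (INR n) - D * ln 2) / ln 2) by (field; lra).
  split; apply Rmult_le_reg_r with (ln 2); try lra;
    unfold Rdiv; rewrite Rmult_assoc, Rinv_l by lra; nra.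
- assert (HN : is_covering_number bounded_analytic_space (F_exp_disk A B) eps
    (covering_number bounded_analytic_space (F_exp_disk A B) eps)).
  { unfold covering_number; apply epsilon_spec; now apply covering_exists. }
  specialize (Hest eps n _ He Hn Hdeg HN).
  unfold H, metric_entropy, log2 at 1.
  set (lnN := ln (INR (covering_number bounded_analytic_space (F_exp_disk A B) eps))) in *.
  replace (lnN / ln 2 - INR n * L) with ((lnN - INR n * el) / ln 2)
    by (rewrite <- HLel; field; lra).
  unfold Rdiv; rewrite Rabs_mult, (Rabs_right (/ ln 2))
    by (apply Rle_ge, Rlt_le, Rinv_0_lt_compat; lra).
  apply Rmult_le_reg_r with (ln 2); [lra|]; rewrite Rmult_assoc, Rinv_l by lra.
  assert (0 <= K2 * INR n ^ 2) by (apply Rmult_le_pos; [exact HK2 | apply pow2_ge_0]).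
  fold el in Hest; nra.
Qed.

Theorem corollary19 (A B : R) (hA : 0 < A) (hB : 0 < B) :
  (forall eps : R, 0 < eps ->
     exists N : nat,
       is_covering_number bounded_analytic_space (F_exp_disk A B) eps N) /\
  exists r : R -> R,
    is_domin (Ku := R_AbsRing) (Kv := R_AbsRing)
             (U := R_NormedModule) (V := R_NormedModule) (at_right 0)
      (fun eps : R => log_iter 3 (/ eps) / log_iter 2 (/ eps)) r /\
    at_right 0 (fun eps : R =>
      metric_entropy bounded_analytic_space (F_exp_disk A B) eps =
      log2 (/ eps) ^ 2 / log_iter 2 (/ eps) *
      (1 + log_iter 3 (/ eps) / log_iter 2 (/ eps) + r eps)).
Proof.
split; [now apply covering_exists|].
assert (near0 : forall (P : R -> Prop) delta, 0 < delta ->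
  (forall eps, 0 < eps < delta -> P eps) -> at_right 0 P).
{ intros P delta Hd HP; exists (mkposreal delta Hd); intros eps Hb Hpos.
  apply HP; split; [exact Hpos|].
  unfold ball in Hb; simpl in Hb; unfold AbsRing_ball, abs, minus, plus, opp in Hb; simpl in Hb.
  apply Rabs_lt_between in Hb; lra. }
exists (fun eps => metric_entropy bounded_analytic_space (F_exp_disk A B) eps
  * log_iter 2 (/ eps) / log2 (/ eps) ^ 2 - 1 - log_iter 3 (/ eps) / log_iter 2 (/ eps)).
split.
- intros eta; destruct (entropy_expansion A B eta hA hB (cond_pos eta)) as [delta [Hd H]].
  apply (near0 _ delta Hd); intros eps Heps.
  destruct (H eps Heps) as [_ [_ H']].
  change (Rabs (metric_entropy bounded_analytic_space (F_exp_disk A B) eps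
    * log_iter 2 (/ eps) / log2 (/ eps) ^ 2 - 1 - log_iter 3 (/ eps) / log_iter 2 (/ eps))
    <= eta * Rabs (log_iter 3 (/ eps) / log_iter 2 (/ eps))).
  eapply Rle_trans; [exact H'|].
  apply Rmult_le_compat_l; [apply Rlt_le, cond_pos | apply Rle_abs].
- destruct (entropy_expansion A B 1 hA hB Rlt_0_1) as [delta [Hd H]].
  apply (near0 _ delta Hd); intros eps Heps.
  destruct (H eps Heps) as [HL [HY _]]; field; lra.
Qed.
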